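(* Let $d\ge 1$ be an integer and consider the grid $\mathbb{Z}^d$ (vertices at Euclidean distance $1$ are joined by an edge) with gossip matrix $W=A(\mathbb{Z}^d)/(2d)$, where $A(\mathbb{Z}^d)$ is the adjacency matrix. Let $\nu$ be a probability law on $\mathbb{R}$ with mean $\mu$ and finite, nonzero variance, let $\xi=(\xi_w)_{w\in\mathbb{Z}^d}$ be i.i.d. samples from $\nu$, and let $x^t$ be the iterates of the Jacobi polynomial iteration with parameter $d$ on $\mathbb{Z}^d$. Then for every vertex $v$, $$\lim_{t\to\infty}\frac{\ln\mathbb{E}[(x^t_v-\mu)^2]}{\ln t}=-d.$$
   Context: Jacobi polynomial iteration with parameter $d$: $x^0=\xi$, $x^1=a_0W\xi+b_0\xi$, $x^{t+1}=a_tWx^t+b_tx^t-c_tx^{t-1}$ for $t\ge1$, where $a_0=\frac{d+4}{2(2+d)}$, $b_0=\frac{d}{2(2+d)}$, and for $t\ge 1$ $$a_t=\frac{(2t+d/2+1)(2t+d/2+2)}{2(t+1+d/2)^2},\quad b_t=\frac{d^2(2t+d/2+1)}{8(t+1+d/2)^2(2t+d/2)},\quad c_t=\frac{t^2(2t+d/2+2)}{(t+1+d/2)^2(2t+d/2)}.$$ *)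

(* Defs.v *)
From HB Require Import structures.
From mathcomp Require Import all_boot all_order all_algebra.
From mathcomp Require Import finmap.
From mathcomp Require Import all_classical all_reals all_analysis.

Set Implicit Arguments.
Unset Strict Implicit.
Unset Printing Implicit Defensive.

Import Order.TTheory GRing.Theory Num.Theory.
Import numFieldNormedType.Exports.

Local Open Scope classical_set_scope.
Local Open Scope ring_scope.

Definition grid (d : nat) := 'rV[int]_d.

Definition euclid_dist (R : realType) (d : nat) (v w : grid d) : R :=
  Num.sqrt (\sum_(i < d) ((v ord0 i - w ord0 i)%:~R ^+ 2)).

Definition grid_adjacency (R : realType) (d : nat) (v w : grid d) : R :=
  if euclid_dist R v w == 1 then 1 else 0.

Definition grid_gossip (R : realType) (d : nat) (v w : grid d) : R :=
  grid_adjacency R v w / (2 * d%:R).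

(* Infinite matrix times vector. [\sum_(w \in setT)] is the finitely supported
   sum, whose junk value 0 on infinite supports never occurs for a matrix with
   finitely many nonzero entries in each row. *)
Definition mxact (R : realType) (V : choiceType) (W : V -> V -> R) (x : V -> R)
    : V -> R :=
  fun v => \sum_(w \in [set: V]) (W v w * x w).

Definition jacobi_a (R : realType) (d : R) (t : nat) : R :=
  if t is 0%N then (d + 4) / (2 * (2 + d))
  else ((2 * t%:R + d / 2 + 1) * (2 * t%:R + d / 2 + 2))
       / (2 * (t%:R + 1 + d / 2) ^+ 2).

Definition jacobi_b (R : realType) (d : R) (t : nat) : R :=
  if t is 0%N then d / (2 * (2 + d))
  else (d ^+ 2 * (2 * t%:R + d / 2 + 1))
       / (8 * (t%:R + 1 + d / 2) ^+ 2 * (2 * t%:R + d / 2)).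

(* Only used for [t >= 1]. *)
Definition jacobi_c (R : realType) (d : R) (t : nat) : R :=
  (t%:R ^+ 2 * (2 * t%:R + d / 2 + 2))
  / ((t%:R + 1 + d / 2) ^+ 2 * (2 * t%:R + d / 2)).

Fixpoint jacobi_iter (R : realType) (V : choiceType) (W : V -> V -> R) (d : R)
    (xi : V -> R) (t : nat) {struct t} : V -> R :=
  match t with
  | 0%N => xi
  | s.+1 =>
    match s with
    | 0%N => fun v => jacobi_a d 0 * mxact W xi v + jacobi_b d 0 * xi v
    | r.+1 => fun v =>
        jacobi_a d s * mxact W (jacobi_iter W d xi s) v
        + jacobi_b d s * jacobi_iter W d xi s v
        - jacobi_c d s * jacobi_iter W d xi r v
    end
  end.

Definition mutually_independent (disp : measure_display)
    (T : measurableType disp) (R : realType) (P : probability T R)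
    (I : choiceType) (X : I -> {RV P >-> measurableTypeR R}) : Prop :=
  forall (F : {fset I}) (B : I -> set (measurableTypeR R)),
    (forall i, measurable (B i)) ->
    P (\bigcap_(i in [set` F]) (X i @^-1` B i))
    = (\prod_(i <- F) P (X i @^-1` B i))%E.

(* Equality of laws is only required on measurable sets, since the values of a
   measure on other sets carry no meaning. *)
Definition iid_samples (disp : measure_display)
    (T : measurableType disp) (R : realType) (P : probability T R)
    (I : choiceType) (X : I -> {RV P >-> measurableTypeR R})
    (nu : probability (measurableTypeR R) R) : Prop :=
  mutually_independent X /\
  forall (i : I) (A : set (measurableTypeR R)),
    measurable A -> distribution P (X i) A = nu A.

(* Main.v *)
(** Writing [x^t_v = sum_u h_t(u) xi_(v+u)] with a finitely supported kernel,
    the error is [sigma^2 S_t] where [S_t = sum_u h_t(u)^2].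

    Lower bound: [h_t] has total mass [1] and lives on a box with [N^d] points,
    [N = 2t + 1], so [S_t >= N^-d] by Cauchy-Schwarz.

    Upper bound: by Parseval on the torus [(Z/N)^d], [N^d S_t] is the sum of
    [pi_t(x_m)^2] over the eigenvalues [x_m = (1/d) sum_i cos(2 pi m_i / N)] of
    the torus, where [pi_t] is the Jacobi polynomial with parameters [(d/2, 0)]
    normalized by [pi_t(1) = 1].  The key estimate is
    [pi_t(x)^2 <= C (t sqrt (1 - x))^-d] on [(-1, 1)], proved by following in [t]
    a quadratic energy of the three-term recurrence, first for [pi_t] up to time
    [1 / sqrt (1 - x)] and then for the classical normalization, whose size at
    [1] is [t^(d/2)].  As [1 - x_m] is at least of order [(max_i |m_i| / N)^2],
    the sum over the torus is at most a power of [ln t], which is negligible on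
    the logarithmic scale. *)

Require Import Defs.
From HB Require Import structures.
From mathcomp Require Import all_boot all_order all_algebra.
From mathcomp Require Import finmap.
From mathcomp Require Import all_classical all_reals all_analysis.
From mathcomp Require Import measurable_realfun.
From mathcomp Require Import ring lra zify.
Import Order.TTheory GRing.Theory Num.Theory.
Import numFieldNormedType.Exports.
Local Open Scope classical_set_scope.
Local Open Scope ring_scope.

(** * Decay of the normalized Jacobi polynomials *)

Fixpoint jacobi_value (R : realType) (d x : R) (t : nat) {struct t} : R :=
  match t with
  | 0%N => 1
  | s.+1 =>
    match s with
    | 0%N => jacobi_a d 0 * x + jacobi_b d 0
    | r.+1 => (jacobi_a d s * x + jacobi_b d s) * jacobi_value R d x s
              - jacobi_c d s * jacobi_value R d x r
    end
  end.
Arguments jacobi_value {R} d x t.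

(* For fixed [x] the recurrence is a perturbation of
   [p_(n+1) = 2 x p_n - p_(n-1)], which preserves the quadratic form
   [p^2 + q^2 - 2 x p q] written here as a sum of squares. *)
Definition energy {R : realType} (x p q : R) : R :=
  (x * q - p) ^+ 2 + (1 - x ^+ 2) * q ^+ 2.

(** The energy is symmetric in [p] and [q], so the new one equals [(x q - r)^2 + (1 - x^2) q^2],
    where [x q - r = -(c (x q - p) + b (1 - x) q)]. For [x = cos theta] with [theta] in [(0, pi)],
    [k] is [tan (theta / 2)] and [k (1 + x)] is [sin theta]. *)
Lemma energy_step {R : realType} {x k b c p q r : R} :
  0 < k -> -1 < x -> x < 1 -> k ^+ 2 * (1 + x) = 1 - x ->
  0 <= c <= 1 -> r = ((1 + c - b) * x + b) * q - c * p ->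
  energy x q r <= (1 + `|b| * k) ^+ 2 * energy x p q.
Proof.
move=> k0 x1 x2 kE /andP[c0 c1] ->.
set y := x * q - p; set z := k * (1 + x) * q; set g := `|b| * k.
have z2 : z ^+ 2 = (1 - x ^+ 2) * q ^+ 2.
  have -> : 1 - x ^+ 2 = (1 - x) * (1 + x) by ring.
  rewrite -kE /z. ring.
have kz : k * z = (1 - x) * q by rewrite -kE /z; ring.
(* Damping ([c <= 1]) only decreases the energy, and [b] enters through
   [(1 - x) q], which the energy controls with the small factor [k]. *)
have -> : energy x q (((1 + c - b) * x + b) * q - c * p)
    = (c * y + b * (k * z)) ^+ 2 + z ^+ 2.
  by rewrite z2 kz /energy /y; ring.
rewrite /energy -/y -z2.
have g0 : 0 <= g by rewrite mulr_ge0 // ltW.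
have h1 : (c * y + b * (k * z)) ^+ 2 <= (`|y| + g * `|z|) ^+ 2.
  rewrite -[leLHS]real_normK ?num_real // ler_sqr ?nnegrE ?addr_ge0 //;
    rewrite ?mulr_ge0 ?(ltW k0) //.
  apply: (le_trans (ler_normD _ _)); apply: lerD.
    by rewrite normrM (ger0_norm c0) ler_piMl.
  by rewrite !normrM (ger0_norm (ltW k0)) mulrA.
apply: (le_trans (lerD h1 (lexx _))).
have := normr_ge0 y; have := normr_ge0 z.
rewrite -(real_normK (num_real y)) -(real_normK (num_real z)).
move: `|y| `|z| => Y Z Z0 Y0.
have := sqr_ge0 (Y - Z); have := mulr_ge0 g0 (sqr_ge0 (Y - Z)).
have := mulr_ge0 g0 (sqr_ge0 Y); have := mulr_ge0 g0 (sqr_ge0 Z).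
have := mulr_ge0 g0 (mulr_ge0 g0 (sqr_ge0 Y)).
nra.
Qed.

(** One step costs at most a factor [exp (2 k |b|)], and the costs from time [m] on add up to at
    most [2 k B / (m + 1)]. Hence even a large [k] is harmless when the start [m] is comparable to
    it. *)
Lemma energy_growth {R : realType} {x k B : R} {p b c : nat -> R} {m : nat} :
  0 < k -> -1 < x -> x < 1 -> k ^+ 2 * (1 + x) = 1 - x -> 0 <= B ->
  (forall n, 0 <= c n <= 1) ->
  (forall n, `|b n| <= B / (n.+1%:R * n.+2%:R)) ->
  (forall n, p n.+2 = ((1 + c n - b n) * x + b n) * p n.+1 - c n * p n) ->
  forall n, (m <= n)%N ->
    energy x (p n) (p n.+1)
      <= expR (2 * k * B / m.+1%:R) * energy x (p m) (p m.+1).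
Proof.
move=> k0 x1 x2 kE B0 hc hb hp n.
have e0 i : 0 <= energy x (p i) (p i.+1).
  by rewrite /energy addr_ge0 ?sqr_ge0 // mulr_ge0 ?sqr_ge0 //; nra.
(* The perturbation is summable: [1 / (i (i + 1))] telescopes. *)
have step i : energy x (p i.+1) (p i.+2)
    <= expR (2 * k * B * (i.+1%:R^-1 - i.+2%:R^-1)) * energy x (p i) (p i.+1).
  apply: le_trans (energy_step k0 x1 x2 kE (hc i) (hp i)) _.
  apply: ler_wpM2r => //.
  have -> : 2 * k * B * (i.+1%:R^-1 - i.+2%:R^-1)
      = (k * (B / (i.+1%:R * i.+2%:R))) * 2%:R.
    rewrite -[i.+2%:R]natr1 -[i.+1%:R]natr1.
    have := ler0n R i; move: (i%:R) => s s0; field.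
    by rewrite !gt_eqF //=; lra.
  rewrite expRM_natr ler_sqr ?nnegrE ?expR_ge0 ?addr_ge0 ?mulr_ge0 ?(ltW k0) //.
  apply: le_trans (expR_ge1Dx _); rewrite lerD2l mulrC.
  by apply: ler_wpM2l => //; exact: ltW.
have main i : energy x (p (m + i)%N) (p (m + i).+1)
    <= expR (2 * k * B * (m.+1%:R^-1 - (m + i).+1%:R^-1))
       * energy x (p m) (p m.+1).
  elim: i => [|i IH]; first by rewrite addn0 subrr mulr0 expR0 mul1r.
  rewrite addnS; apply: le_trans (step _) _.
  apply: le_trans (ler_wpM2l (expR_ge0 _) IH) _.
  by rewrite mulrA -expRD -mulrDr addrC addrA subrK.
move=> /subnKC <-; apply: le_trans (main _) _.
apply: ler_wpM2r => //; rewrite ler_expR; apply: ler_wpM2l.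
  by rewrite !mulr_ge0 // ltW.
by rewrite gerBl.
Qed.

(** This is what normalizes the polynomials to the value 1 at 1, and it brings the recurrence into
    the shape of [energy_step]. *)
Lemma jacobi_aE {R : realType} {d : R} {t : nat} : 0 <= d ->
  jacobi_a d t.+1 = 1 + jacobi_c d t.+1 - jacobi_b d t.+1.
Proof.
move=> d0; rewrite /jacobi_a /jacobi_b /jacobi_c.
by have t0 := ler0n R t; field; rewrite !gt_eqF //=; lra.
Qed.

Lemma jacobi_c_itv {R : realType} {d : R} {t : nat} : 0 <= d ->
  0 <= jacobi_c d t.+1 <= 1.
Proof.
move=> d0; rewrite /jacobi_c -natr1.
have := ler0n R t; move: (t%:R) => s s0.
have h : 0 < (s + 1 + 1 + d / 2) ^+ 2 * (2 * (s + 1) + d / 2).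
  by rewrite mulr_gt0 ?exprn_gt0 //; lra.
have h0 : 0 <= (s + 1) ^+ 2 * (2 * (s + 1) + d / 2 + 2).
  by rewrite mulr_ge0 ?sqr_ge0 //; lra.
rewrite divr_ge0 ?(ltW h) //= ler_pdivrMr // mul1r -subr_ge0.
set u := s + 1; set e := d / 2.
have -> : (u + 1 + e) ^+ 2 * (2 * u + e) - u ^+ 2 * (2 * u + e + 2)
    = 2 * u ^+ 2 + 4 * (u ^+ 2 * e) + 2 * u * (1 + e) ^+ 2
      + e * (2 * u * (1 + e) + (1 + e) ^+ 2) by ring.
have [u0 e0] : 0 <= u /\ 0 <= e by rewrite /u /e; split; lra.
by rewrite !addr_ge0 // !mulr_ge0 // ?addr_ge0 // ?mulr_ge0 ?sqr_ge0 ?addr_ge0.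
Qed.

Lemma jacobi_b_bound {R : realType} {d : R} {t : nat} : 0 <= d ->
  0 <= jacobi_b d t.+1 <= (d / 2) ^+ 2 / (t.+1%:R * t.+2%:R).
Proof.
move=> d0; rewrite /jacobi_b -[t.+2%:R]natr1 -[t.+1%:R]natr1.
have := ler0n R t; move: (t%:R) => s s0.
have h : 0 < (s + 1 + 1 + d / 2) ^+ 2 * (2 * (s + 1) + d / 2).
  by rewrite mulr_gt0 ?exprn_gt0 //; lra.
have h8 : 0 < 8 * (s + 1 + 1 + d / 2) ^+ 2 * (2 * (s + 1) + d / 2).
  by rewrite -mulrA mulr_gt0.
have h0 : 0 <= d ^+ 2 * (2 * (s + 1) + d / 2 + 1).
  by rewrite mulr_ge0 ?sqr_ge0 //; lra.
rewrite divr_ge0 ?(ltW h8) //=.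
rewrite ler_pdivrMr // [leRHS]mulrAC ler_pdivlMr; last by rewrite mulr_gt0; lra.
rewrite -subr_ge0.
set u := _ - _.
have -> : u = d ^+ 2 * (2 * (s + 1 + 1 + d / 2) ^+ 2 * (2 * (s + 1) + d / 2)
   - (2 * (s + 1) + d / 2 + 1) * ((s + 1) * (s + 1 + 1))) by rewrite /u; field.
rewrite mulr_ge0 ?sqr_ge0 // subr_ge0 [leRHS]mulrAC.
apply: ler_pM; [by lra | by rewrite mulr_ge0; lra | by lra | by nra].
Qed.

(** For [x >= 0] the tangent [k] is at most 1, so the growth from time 0 on is bounded. The factor
    [1 - x] comes from the initial energy, which is [(b_0 (1 - x))^2 + (1 - x^2)]. *)
Lemma jacobi_value_energy {R : realType} {d x : R} {n : nat} :
  0 <= d -> 0 <= x < 1 ->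
  energy x (jacobi_value d x n) (jacobi_value d x n.+1)
    <= 3 * expR (2 * (d / 2) ^+ 2) * (1 - x).
Proof.
move=> d0 /andP[x0 x1].
set k := Num.sqrt ((1 - x) / (1 + x)).
have q0 : 0 < (1 - x) / (1 + x) by rewrite divr_gt0; lra.
have k0 : 0 < k by rewrite sqrtr_gt0.
have kE : k ^+ 2 * (1 + x) = 1 - x.
  by rewrite sqr_sqrtr ?ltW // divfK // gt_eqF //; lra.
have k1 : k <= 1.
  by rewrite -sqrtr1 ler_wsqrtr // ler_pdivrMr; lra.
have x1' : -1 < x by lra.
have bb i : `|jacobi_b d i.+1| <= (d / 2) ^+ 2 / (i.+1%:R * i.+2%:R).
  by have /andP[h1 h2] := jacobi_b_bound (t := i) d0; rewrite ger0_norm.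
have rec i : jacobi_value d x i.+2
    = ((1 + jacobi_c d i.+1 - jacobi_b d i.+1) * x + jacobi_b d i.+1)
      * jacobi_value d x i.+1 - jacobi_c d i.+1 * jacobi_value d x i.
  by rewrite -jacobi_aE.
have := energy_growth k0 x1' x1 kE (sqr_ge0 (d / 2))
  (fun i => jacobi_c_itv (t := i) d0) bb rec n (leq0n n).
rewrite divr1 => /le_trans; apply.
have e1 : energy x (jacobi_value d x 0) (jacobi_value d x 1) <= 3 * (1 - x).
  have -> : energy x (jacobi_value d x 0) (jacobi_value d x 1)
      = (d / (2 * (2 + d)) * (1 - x)) ^+ 2 + (1 - x ^+ 2).
    by rewrite /energy /= /jacobi_a /jacobi_b; field; rewrite gt_eqF //; lra.
  have : 0 <= d / (2 * (2 + d)) <= 1.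
    by rewrite divr_ge0 ?ler_pdivrMr; lra.
  move: (d / _) => b /andP[b0 b1].
  have : b * (1 - x) <= 1 - x by rewrite ler_piMl; lra.
  have : 0 <= b * (1 - x) by rewrite mulr_ge0; lra.
  by move: (b * _) => u u0 u1; nra.
rewrite (mulrC 3) -[leRHS]mulrA; apply: ler_pM => //.
- by rewrite /energy addr_ge0 ?sqr_ge0 // mulr_ge0 ?sqr_ge0 //; nra.
- rewrite ler_expR; apply: ler_wpM2r; first exact: sqr_ge0.
  by rewrite ler_piMr.
Qed.

(* The generalized binomial coefficient of [n + d/2] over [n], i.e. the value at
   [1] of the classical Jacobi polynomial with parameters [(d/2, 0)]. *)
Definition jacobi_norm {R : realType} (d : R) (n : nat) : R :=
  \prod_(j < n) (1 + d / 2 / j.+1%:R).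

Lemma jacobi_normS {R : realType} (d : R) (n : nat) :
  jacobi_norm d n.+1 = jacobi_norm d n * (1 + d / 2 / n.+1%:R).
Proof. by rewrite /jacobi_norm big_ord_recr. Qed.

Lemma bernoulli {R : realType} (y : R) (n : nat) :
  -1 <= y -> 1 + n%:R * y <= (1 + y) ^+ n.
Proof.
move=> y1; elim: n => [|n IH]; first by rewrite mul0r addr0 expr0.
have h : 0 <= 1 + y by lra.
rewrite exprS; apply: le_trans (ler_wpM2l h IH).
have := ler0n R n; rewrite -natr1; nra.
Qed.

(** Replacing [n] by [n + d] on the left makes the case [n = 0] an equality, and turns the induction
    step into Bernoulli's inequality at [-1 / (n + d + 1)]. *)
Lemma jacobi_norm_ge {R : realType} (d n : nat) :
  n%:R ^+ d <= d%:R ^+ d * jacobi_norm (d%:R : R) n ^+ 2.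
Proof.
suff h : (n + d)%:R ^+ d <= d%:R ^+ d * jacobi_norm (d%:R : R) n ^+ 2.
  by apply: le_trans h; rewrite lerXn2r ?nnegrE // ler_nat leq_addr.
elim: n => [|n IH].
  by rewrite /jacobi_norm big_ord0 expr1n mulr1.
rewrite jacobi_normS exprMn mulrA.
have h1 : 1 + d%:R / n.+1%:R <= (1 + d%:R / 2 / n.+1%:R) ^+ 2 :> R.
  have : 0 <= d%:R / n.+1%:R :> R by rewrite divr_ge0.
  have -> : d%:R / 2 / n.+1%:R = d%:R / n.+1%:R / 2 :> R by rewrite mulrAC.
  by move: (d%:R / n.+1%:R) => u u0; nra.
have h0 : 0 <= 1 + d%:R / n.+1%:R :> R by rewrite addr_ge0 // divr_ge0.
apply: le_trans (ler_pM _ h0 IH h1); last by rewrite exprn_ge0.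
rewrite addSn.
have s0 : 0 < (n + d).+1%:R :> R by [].
have := @bernoulli R (- (n + d).+1%:R^-1) d.
have -> : 1 - (n + d).+1%:R^-1 = (n + d)%:R / (n + d).+1%:R :> R.
  by rewrite -[(n + d)%:R](addrK 1) natr1 mulrBl divff ?pnatr_eq0 // mul1r.
rewrite lerN2 invf_le1 // ler1n => /(_ isT).
rewrite expr_div_n ler_pdivlMr ?exprn_gt0 // => h.
have -> : (n + d).+1%:R ^+ d
    = (1 + d%:R / n.+1%:R) * ((1 + d%:R * - (n + d).+1%:R^-1)
        * (n + d).+1%:R ^+ d) :> R.
  rewrite mulrA -[LHS]mul1r; congr (_ * _).
  rewrite -addSn natrD; have := ler0n R d; have : 0 < n.+1%:R :> R by [].
  by move: n.+1%:R d%:R => u w u0 w0; field; rewrite !gt_eqF //; lra.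
by rewrite [leRHS]mulrC; exact: (ler_wpM2l h0 h).
Qed.

(** With [y = 1 / (2 (n + 2))], Bernoulli bounds the new factor by [(1 + y)^d], and
    [(n + 1) (1 + y)^2 <= n + 2]. *)
Lemma jacobi_norm_le {R : realType} (d n : nat) :
  jacobi_norm (d%:R : R) n.+1 ^+ 2 <= (1 + d%:R / 2) ^+ 2 * n.+1%:R ^+ d.
Proof.
elim: n => [|n IH].
  by rewrite jacobi_normS /jacobi_norm big_ord0 mul1r divr1 expr1n mulr1.
rewrite jacobi_normS exprMn.
apply: le_trans (ler_wpM2r (sqr_ge0 _) IH) _.
rewrite -[leLHS]mulrA; apply: ler_wpM2l; first exact: sqr_ge0.
set y : R := (2 * n.+2%:R)^-1.
have y0 : 0 <= y by rewrite invr_ge0 mulr_ge0.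
have h1 : (1 + d%:R / 2 / n.+2%:R) ^+ 2 <= ((1 + y) ^+ 2) ^+ d.
  rewrite exprAC ler_sqr ?nnegrE ?exprn_ge0 ?addr_ge0 ?divr_ge0 //.
  rewrite -mulrA -invfM; by apply: bernoulli; rewrite (le_trans _ y0) // oppr_le0.
apply: le_trans (ler_wpM2l (exprn_ge0 _ (ler0n _ _)) h1) _.
have h2 : n.+1%:R * (1 + y) ^+ 2 <= n.+2%:R.
  have yE : y * (2 * n.+2%:R) = 1 by rewrite mulVf // mulf_neq0 // pnatr_eq0.
  move: yE; rewrite -[n.+2%:R]natr1.
  by have := ler0n R n.+1; move: (n.+1%:R) => s s0; nra.
by rewrite -exprMn lerXn2r // nnegrE // mulr_ge0 ?sqr_ge0.
Qed.

(** The Jacobi polynomial with parameters [(d/2, 0)] in its classical normalization. *)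
Definition jacobi_poly {R : realType} (d x : R) (n : nat) : R :=
  jacobi_norm d n * jacobi_value d x n.

(** By reflection, [(-1)^n P_n(x)] is the Jacobi polynomial with parameters [(0, d/2)] at [-x]. That
    one has value 1 at 1, so [energy_growth] applies to it. Its [k] blows up as [x] tends to 1, but
    [k / (m + 1) <= 2] from the time [1 / sqrt (1 - x)] on. *)
Lemma jacobi_poly_energy {R : realType} {d x : R} {m n : nat} :
  0 <= d -> -1 < x < 1 -> 1 <= m.+1%:R * Num.sqrt (1 - x) -> (m <= n)%N ->
  energy x (jacobi_poly d x n) (jacobi_poly d x n.+1)
    <= expR (4 * (d / 2) ^+ 2)
       * energy x (jacobi_poly d x m) (jacobi_poly d x m.+1).
Proof.
move=> d0 /andP[x0 x1] hm hmn.
set k := Num.sqrt ((1 + x) / (1 - x)).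
have q0 : 0 < (1 + x) / (1 - x) by rewrite divr_gt0; lra.
have k0 : 0 < k by rewrite sqrtr_gt0.
have kE : k ^+ 2 * (1 + - x) = 1 - - x.
  by rewrite opprK sqr_sqrtr ?ltW // divfK // gt_eqF //; lra.
have k1 : k / m.+1%:R <= 2.
  rewrite ler_pdivrMr //.
  have s0 : 0 <= 1 - x by lra.
  have h : 1 <= (m.+1%:R * Num.sqrt (1 - x)) ^+ 2 by rewrite exprn_ege1.
  rewrite exprMn sqr_sqrtr // in h.
  rewrite -[leRHS]ger0_norm ?mulr_ge0 // -sqrtr_sqr; apply: ler_wsqrtr.
  rewrite ler_pdivrMr; last by lra.
  by move: h; move: (m.+1%:R) => u; nra.
have energyN u v : energy (- x) u (- v) = energy x u v.
  by rewrite /energy; ring.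
(* The alternating sequence satisfies at [-x] a recurrence of the same shape,
   with [b] replaced by a negative coefficient. *)
pose p i := (-1) ^+ i * jacobi_poly d x i.
have pE i : energy (- x) (p i) (p i.+1)
    = energy x (jacobi_poly d x i) (jacobi_poly d x i.+1).
  rewrite /p exprS mulN1r mulNr energyN /energy.
  transitivity (((-1) ^+ i * (-1) ^+ i) *
     energy x (jacobi_poly d x i) (jacobi_poly d x i.+1)).
    by rewrite /energy; ring.
  by rewrite -expr2 sqrr_sign mul1r.
pose r i : R := 1 + d / 2 / i.+1%:R.
pose c i := jacobi_c d i.+1 * (r i.+1 * r i).
pose b i := - (jacobi_b d i.+1 * r i.+1).
have c01 i : 0 <= c i <= 1.
  rewrite /c /r /jacobi_c -[i.+2%:R]natr1 -[i.+1%:R]natr1.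
  have := ler0n R i; move: (i%:R) => s s0.
  set e := d / 2; have e0 : 0 <= e by rewrite /e; lra.
  have -> : (s + 1) ^+ 2 * (2 * (s + 1) + e + 2)
      / ((s + 1 + 1 + e) ^+ 2 * (2 * (s + 1) + e))
      * ((1 + e / (s + 1 + 1)) * (1 + e / (s + 1)))
      = ((s + 1) * (s + 1 + e) * (2 * (s + 1) + e + 2))
        / ((s + 1 + 1) * (s + 1 + 1 + e) * (2 * (s + 1) + e)).
    by field; rewrite !gt_eqF //; lra.
  have h : 0 < (s + 1 + 1) * (s + 1 + 1 + e) * (2 * (s + 1) + e).
    by rewrite !mulr_gt0 //; lra.
  have h0 : 0 <= (s + 1) * (s + 1 + e) * (2 * (s + 1) + e + 2).
    by rewrite !mulr_ge0 //; lra.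
  rewrite divr_ge0 ?(ltW h) //= ler_pdivrMr // mul1r -subr_ge0.
  have -> : (s + 1 + 1) * (s + 1 + 1 + e) * (2 * (s + 1) + e) -
      (s + 1) * (s + 1 + e) * (2 * (s + 1) + e + 2)
      = 2 * (s + 1) ^+ 2 + 2 * ((s + 1) * e) + e ^+ 2 + 2 * (s + 1) + e.
    by ring.
  by rewrite !addr_ge0 // ?mulr_ge0 ?sqr_ge0 //; lra.
have bb i : `|b i| <= (d / 2) ^+ 2 / (i.+1%:R * i.+2%:R).
  rewrite /b /r normrN /jacobi_b -[i.+2%:R]natr1 -[i.+1%:R]natr1.
  have := ler0n R i; move: (i%:R) => s s0.
  set e := d / 2; have e0 : 0 <= e by rewrite /e; lra.
  have -> : d = 2 * e by rewrite /e; lra.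
  have -> : (2 * e) ^+ 2 * (2 * (s + 1) + e + 1)
      / (8 * (s + 1 + 1 + e) ^+ 2 * (2 * (s + 1) + e)) * (1 + e / (s + 1 + 1))
      = e ^+ 2 * ((2 * (s + 1) + e + 1)
        / (2 * (2 * (s + 1) + e) * ((s + 1 + 1 + e) * (s + 1 + 1)))).
    by field; rewrite !gt_eqF //; lra.
  have h : 0 < (s + 1) * (s + 1 + 1) by rewrite !mulr_gt0 //; lra.
  have h' : 0 < 2 * (2 * (s + 1) + e) * ((s + 1 + 1 + e) * (s + 1 + 1)).
    by rewrite !mulr_gt0 //; lra.
  rewrite ger0_norm; last first.
    by rewrite mulr_ge0 ?sqr_ge0 // divr_ge0 ?(ltW h') //; lra.
  apply: ler_wpM2l; first exact: sqr_ge0.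
  rewrite ler_pdivrMr // [leRHS]mulrC ler_pdivlMr //.
  by apply: ler_pM; [lra | exact: ltW | lra | nra].
have rec i : p i.+2
    = ((1 + c i - b i) * - x + b i) * p i.+1 - c i * p i.
  have aE : jacobi_a d i.+1 * r i.+1 = 1 + c i - b i.
    rewrite /b /c /r /jacobi_a /jacobi_b /jacobi_c.
    rewrite -[i.+2%:R]natr1 -[i.+1%:R]natr1.
    have := ler0n R i; move: (i%:R) => s s0.
    by field; rewrite !gt_eqF //; lra.
  rewrite /p /jacobi_poly !jacobi_normS -aE /c /b -/(r i) -/(r i.+1).
  have -> : jacobi_value d x i.+2
      = (jacobi_a d i.+1 * x + jacobi_b d i.+1) * jacobi_value d x i.+1
        - jacobi_c d i.+1 * jacobi_value d x i by [].
  by rewrite !exprS; ring.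
have hx0 : -1 < - x by lra.
have hx1 : - x < 1 by lra.
have := energy_growth k0 hx0 hx1 kE (sqr_ge0 (d / 2)) c01 bb rec n hmn.
rewrite !pE => /le_trans; apply; apply: ler_wpM2r.
  by rewrite /energy addr_ge0 ?sqr_ge0 // mulr_ge0 ?sqr_ge0 //; nra.
rewrite ler_expR mulrAC; apply: ler_wpM2r; first exact: sqr_ge0.
by rewrite -mulrA [leRHS](_ : 4 = 2 * 2); [rewrite ler_wpM2l|ring].
Qed.

Lemma sqr_le_energy {R : realType} (x p q : R) :
  (1 - x ^+ 2) * q ^+ 2 <= energy x p q.
Proof. by rewrite /energy lerDr sqr_ge0. Qed.

(** For [x >= 0] one has [1 - x <= 1 - x^2], so the factor [1 - x] of the energy bound cancels. *)
Lemma jacobi_value_sqr_le {R : realType} {d x : R} {n : nat} :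
  0 <= d -> 0 <= x < 1 ->
  jacobi_value d x n ^+ 2 <= 3 * expR (2 * (d / 2) ^+ 2).
Proof.
move=> d0 hx; have /andP[x0 x1] := hx.
case: n => [|n].
  rewrite expr1n; have : 1 <= expR (2 * (d / 2) ^+ 2).
    by rewrite -expR0 ler_expR mulr_ge0 ?sqr_ge0.
  by lra.
have := le_trans (sqr_le_energy _ _ _) (jacobi_value_energy (n := n) d0 hx).
have := sqr_ge0 (jacobi_value d x n.+1).
have := expR_ge0 (2 * (d / 2) ^+ 2).
move: (expR _) (jacobi_value _ _ _ ^+ 2) => e p e0 p0 h.
have h1 : 0 < 1 - x by lra.
rewrite -(ler_pM2r h1); apply: le_trans h.
by rewrite mulrC; apply: ler_wpM2r => //; nra.
Qed.

(** Hands the energy bound over from one normalization to the other. The change adds [e x q] to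
    [x q - p], with [e = d / (2 (m + 1))], and the condition on [m] gives [e^2 <= (d/2)^2 (1 - x)],
    which is of the order already present. *)
Lemma jacobi_poly_energy_start {R : realType} {d m : nat} {x : R} :
  0 <= x < 1 -> 1 <= m.+1%:R * Num.sqrt (1 - x) ->
  energy x (jacobi_poly d%:R x m) (jacobi_poly d%:R x m.+1)
    <= (9 + 6 * (d%:R / 2) ^+ 2) * expR (2 * (d%:R / 2) ^+ 2)
       * jacobi_norm d%:R m.+1 ^+ 2 * (1 - x ^+ 2).
Proof.
move=> hx hm; have /andP[x0 x1] := hx.
have d0 : 0 <= d%:R :> R by [].
rewrite /jacobi_poly jacobi_normS.
have hC : 0 <= d%:R / 2 / m.+1%:R :> R by rewrite !divr_ge0.
have hm2 : (d%:R / 2 / m.+1%:R) ^+ 2 <= (d%:R / 2) ^+ 2 * (1 - x).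
  rewrite exprMn; apply: ler_wpM2l; first exact: sqr_ge0.
  have : 1 <= (m.+1%:R * Num.sqrt (1 - x)) ^+ 2 by rewrite exprn_ege1.
  rewrite exprMn sqr_sqrtr ?subr_ge0 ?(ltW x1) // => h.
  by rewrite exprVn -div1r ler_pdivrMr ?exprn_gt0 // mulrC.
have hv := jacobi_value_sqr_le (n := m.+1) d0 hx.
have hE := jacobi_value_energy (n := m) d0 hx.
have hN := sqr_ge0 (jacobi_norm (d%:R : R) m).
have he := expR_gt0 (2 * (d%:R / 2 : R) ^+ 2).
move: (expR _) he hv hE => K K0 hv hE.
move: (d%:R / 2 / m.+1%:R) hC hm2 => e e0 e2.
move: ((d%:R / 2) ^+ 2) (sqr_ge0 (d%:R / 2 : R)) e2 => A A0 e2.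
move: (jacobi_norm _ m) hN (jacobi_value _ x m) (jacobi_value _ x m.+1) hv hE.
move=> N N0 p q hv hE.
have -> : energy x (N * p) (N * (1 + e) * q)
    = N ^+ 2 * (((x * q - p) + e * (x * q)) ^+ 2
       + (1 - x ^+ 2) * ((1 + e) * q) ^+ 2) by rewrite /energy; ring.
have -> : (9 + 6 * A) * K * (N * (1 + e)) ^+ 2 * (1 - x ^+ 2)
  = N ^+ 2 * ((9 + 6 * A) * K * (1 + e) ^+ 2 * (1 - x ^+ 2)) by ring.
apply: ler_wpM2l => //.
have hY : (x * q - p) ^+ 2 <= 3 * K * (1 - x).
  by apply: le_trans hE; rewrite /energy lerDl mulr_ge0 ?sqr_ge0 //; nra.
have hxq : (x * q) ^+ 2 <= 3 * K.
  apply: le_trans hv; rewrite exprMn ler_piMl ?sqr_ge0 //.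
  by rewrite expr_le1 // ltW.
have hexq : (e * (x * q)) ^+ 2 <= A * (1 - x) * (3 * K).
  by rewrite exprMn; apply: ler_pM => //; exact: sqr_ge0.
have h1 : 1 - x <= 1 - x ^+ 2 by nra.
have hs : ((x * q - p) + e * (x * q)) ^+ 2 <= (6 + 6 * A) * K * (1 - x).
  have := sqr_ge0 ((x * q - p) - e * (x * q)).
  move: (x * q - p) (e * (x * q)) hY hexq => u w hu hw huw.
  have -> : (6 + 6 * A) * K * (1 - x)
     = 2 * (3 * K * (1 - x)) + 2 * (A * (1 - x) * (3 * K)) by ring.
  by nra.
have h2 : 0 <= 1 - x ^+ 2 by nra.
have he1 : 1 <= (1 + e) ^+ 2 by rewrite exprn_ege1 // lerDl.
have hs' : (6 + 6 * A) * K * (1 - x)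
    <= (6 + 6 * A) * K * (1 + e) ^+ 2 * (1 - x ^+ 2).
  rewrite -[leRHS]mulrA; apply: ler_wpM2l.
    by rewrite mulr_ge0 ?(ltW K0) //; lra.
  by apply: le_trans h1 _; rewrite ler_peMl.
have hq : (1 - x ^+ 2) * ((1 + e) * q) ^+ 2
    <= 3 * K * (1 + e) ^+ 2 * (1 - x ^+ 2).
  rewrite mulrC; apply: ler_wpM2r => //; rewrite exprMn mulrC.
  by apply: ler_wpM2r; rewrite ?sqr_ge0.
have -> : (9 + 6 * A) * K * (1 + e) ^+ 2 * (1 - x ^+ 2)
    = (6 + 6 * A) * K * (1 + e) ^+ 2 * (1 - x ^+ 2)
      + 3 * K * (1 + e) ^+ 2 * (1 - x ^+ 2) by ring.
by apply: lerD => //; exact: le_trans hs'.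
Qed.

Lemma jacobi_poly_energy_start0 {R : realType} {d x : R} :
  0 <= d -> -1 < x <= 0 ->
  energy x (jacobi_poly d x 0) (jacobi_poly d x 1)
    <= (1 + (d / 2) ^+ 2) * (1 - x ^+ 2).
Proof.
move=> d0 /andP[x0 x1].
have -> : energy x (jacobi_poly d x 0) (jacobi_poly d x 1)
    = (d / 4) ^+ 2 * (1 + x) ^+ 2 + (1 - x ^+ 2).
  rewrite /energy /jacobi_poly /jacobi_norm /= big_ord0 big_ord_recr big_ord0 /=.
  rewrite /jacobi_a /jacobi_b; field; rewrite !gt_eqF //; lra.
have : (1 + x) ^+ 2 <= 1 - x ^+ 2 by nra.
have : 0 <= (1 + x) ^+ 2 by exact: sqr_ge0.
have -> : (d / 4) ^+ 2 = (d / 2) ^+ 2 / 4 by field.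
have := sqr_ge0 (d / 2); move: ((d / 2) ^+ 2) ((1 + x) ^+ 2) (1 - x ^+ 2).
by move=> a u w; nra.
Qed.

(** The energy controls [(1 - x^2) P^2], so [1 - x^2] cancels. Dividing by the squared norm, at
    least [(n / d)^d], gives the decay in [n], and [(m + 1) sqrt (1 - x) <= 2] absorbs the factor
    [(m + 1)^d] of the starting energy. *)
Lemma jacobi_value_decay_from {R : realType} {d m n : nat} {x K : R} :
  -1 < x < 1 -> 1 <= m.+1%:R * Num.sqrt (1 - x) <= 2 ->
  energy x (jacobi_poly d%:R x m) (jacobi_poly d%:R x m.+1)
    <= K * m.+1%:R ^+ d * (1 - x ^+ 2) -> (m <= n)%N ->
  jacobi_value d%:R x n.+1 ^+ 2 * (n.+1%:R * Num.sqrt (1 - x)) ^+ d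
    <= d%:R ^+ d * (expR (4 * (d%:R / 2) ^+ 2) * K * 2 ^+ d).
Proof.
move=> hx /andP[hm1 hm2] hK hmn; have /andP[x0 x1] := hx.
have d0 : 0 <= d%:R :> R by [].
have w0 : 0 < 1 - x ^+ 2 by nra.
have hP : jacobi_poly d%:R x n.+1 ^+ 2
    <= expR (4 * (d%:R / 2) ^+ 2) * (K * m.+1%:R ^+ d).
  rewrite -(ler_pM2r w0) -[leRHS]mulrA [leLHS]mulrC.
  apply: le_trans (ler_wpM2l (expR_ge0 _) hK).
  exact: le_trans (sqr_le_energy _ _ _) (jacobi_poly_energy d0 hx hm1 hmn).
have s0 : 0 <= Num.sqrt (1 - x) by exact: sqrtr_ge0.
move: (Num.sqrt _) s0 hm1 hm2 => s s0 hm1 hm2.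
rewrite exprMn [leLHS]mulrA.
have h1 : jacobi_value d%:R x n.+1 ^+ 2 * n.+1%:R ^+ d
    <= d%:R ^+ d * jacobi_poly d%:R x n.+1 ^+ 2.
  rewrite /jacobi_poly exprMn mulrA mulrC; apply: ler_wpM2r.
    exact: sqr_ge0.
  exact: jacobi_norm_ge.
apply: le_trans (ler_wpM2r (exprn_ge0 _ s0) h1) _.
rewrite -[leLHS]mulrA; apply: ler_wpM2l; first exact: exprn_ge0.
apply: le_trans (ler_wpM2r (exprn_ge0 _ s0) hP) _.
have hK0 : 0 <= K.
  have : 0 <= K * m.+1%:R ^+ d * (1 - x ^+ 2).
    apply: le_trans hK.
    by rewrite /energy addr_ge0 ?sqr_ge0 // mulr_ge0 ?sqr_ge0 // ltW.
  by rewrite pmulr_lge0 // pmulr_lge0 // exprn_gt0.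
rewrite -[leLHS]mulrA -[leRHS]mulrA; apply: ler_wpM2l; first exact: expR_ge0.
rewrite -[leLHS]mulrA -exprMn; apply: ler_wpM2l => //.
by rewrite lerXn2r // nnegrE // mulr_ge0.
Qed.

Lemma jacobi_value_decay (R : realType) (d : nat) :
  exists2 C : R, 0 < C & forall (x : R) (t : nat), -1 < x < 1 -> (0 < t)%N ->
    jacobi_value d%:R x t ^+ 2 * (t%:R * Num.sqrt (1 - x)) ^+ d <= C.
Proof.
set A : R := (d%:R / 2) ^+ 2; set E := expR (2 * A).
have A0 : 0 <= A by exact: sqr_ge0.
have E1 : 1 <= E by rewrite /E -expR0 ler_expR mulr_ge0.
set D : R := (1 + d%:R / 2) ^+ 2.
have D1 : 1 <= D by rewrite exprn_ege1 // lerDl divr_ge0.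
set K : R := (9 + 6 * A) * E * D.
(* One constant [K] thus serves both starting energies, at time 0 for [x < 0] and at time [m] for
   [x >= 0]. *)
have K1 : 1 + A <= K.
  rewrite /K -mulrA; apply: (@le_trans _ _ ((9 + 6 * A) * 1)); first by lra.
  by apply: ler_wpM2l; [lra | rewrite mulr_ege1].
set C := d%:R ^+ d * (expR (4 * A) * K * 2 ^+ d).
have C0 : 0 <= C.
  by rewrite !mulr_ge0 ?exprn_ge0 ?expR_ge0 //; lra.
exists (C + 3 * E); first by lra.
move=> x [//|n] hx _; have /andP[x0 x1] := hx.
have s0 : 0 < Num.sqrt (1 - x) by rewrite sqrtr_gt0; lra.
have s2 : Num.sqrt (1 - x) ^+ 2 = 1 - x by rewrite sqr_sqrtr //; lra.
have [hx0|hx0] := leP 0 x; last first.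
  suff : jacobi_value d%:R x n.+1 ^+ 2 * (n.+1%:R * Num.sqrt (1 - x)) ^+ d <= C.
    by lra.
  (* For [x < 0], [sqrt (1 - x)] already lies between 1 and 2, so the classical normalization can be
     used from time 0. *)
  apply: (jacobi_value_decay_from (m := 0)) => //; first by rewrite mul1r; nra.
  have hx' : -1 < x <= 0 by rewrite x0 ltW.
  apply: le_trans (jacobi_poly_energy_start0 (ler0n _ d) hx') _.
  by rewrite expr1n mulr1; apply: ler_wpM2r => //; nra.
have hx' : 0 <= x < 1 by rewrite hx0.
(* Up to time [1 / sqrt (1 - x)] the values stay bounded; from then on the energy
   of the classical normalization takes over. *)
have /truncn_itv/andP[hm1 hm2] : 0 <= (Num.sqrt (1 - x))^-1.
  by rewrite invr_ge0 ltW.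
(* The integer part of [1 / sqrt (1 - x)]: since [sqrt (1 - x) <= 1], the product
   [(m + 1) sqrt (1 - x)] lies in [[1, 2]]. *)
set m := Num.truncn _ in hm1 hm2.
have hm1' : m%:R * Num.sqrt (1 - x) <= 1.
  by rewrite -ler_pdivlMr // div1r.
have hm2' : 1 <= m.+1%:R * Num.sqrt (1 - x).
  by rewrite -ler_pdivrMr // div1r ltW.
have [hmn|hnm] := leqP m n.
  suff : jacobi_value d%:R x n.+1 ^+ 2 * (n.+1%:R * Num.sqrt (1 - x)) ^+ d <= C.
    by lra.
  apply: (jacobi_value_decay_from (m := m)) => //.
    rewrite hm2' /= -natr1 mulrDl mul1r; nra.
  apply: le_trans (jacobi_poly_energy_start hx' hm2') _.
  apply: ler_wpM2r; first by nra.
  rewrite /K -[leRHS]mulrA; apply: ler_wpM2l; last exact: jacobi_norm_le.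
  by rewrite mulr_ge0 //; lra.
suff : jacobi_value d%:R x n.+1 ^+ 2 * (n.+1%:R * Num.sqrt (1 - x)) ^+ d
    <= 3 * E by lra.
apply: le_trans (jacobi_value_sqr_le (n := n.+1) (ler0n _ d) hx').
rewrite ler_piMr ?sqr_ge0 // exprn_ile1 //.
apply: le_trans hm1'; apply: ler_wpM2r; first exact: ltW.
by rewrite ler_nat.
Qed.

(** * Fourier analysis on the discrete torus *)

(** Halving the angle, [sin y = 2 sin z cos z] and [sin z = z cos c] by the mean value theorem. Both
    cosines are at least [cos (pi / 4)], whose square is [1 / 2]. *)
Lemma sin_ge_half {R : realType} (y : R) : 0 <= y <= pi / 2 -> y / 2 <= sin y.
Proof.
move=> /andP[y0 y1]; set z := y / 2; have pi0 := pi_ge0 R.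
have z0 : 0 <= z by rewrite /z; lra.
have z1 : z <= pi / 4 by rewrite /z; lra.
have c4 : cos (pi / 4 : R) ^+ 2 = 1 / 2.
  have := cos_mulr2n (pi / 4 : R).
  have -> : (pi / 4 : R) *+ 2 = pi / 2 by rewrite -mulr_natr; field.
  by rewrite cos_pihalf -mulr_natr; lra.
have c40 : 0 <= cos (pi / 4 : R).
  by apply: cos_ge0_pihalf; apply/andP; split; lra.
have cle u : 0 <= u <= pi / 4 -> cos (pi / 4) <= cos u.
  move=> /andP[u0 u1]; rewrite leNgt; apply/negP.
  by rewrite ltr_cos ?in_itv /= ?u0 //; lra.
have [c cI] : exists2 c : R, c \in `[0, z] & sin z - sin 0 = cos c * (z - 0).
  apply: MVT_segment => //.
  by apply: continuous_subspaceT => u; exact: continuous_sin.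
rewrite sin0 !subr0 => sE.
have hc : cos (pi / 4) <= cos c.
  by apply: cle; move: cI; rewrite in_itv /=; lra.
have hz : cos (pi / 4) <= cos z by apply: cle; lra.
have -> : y = z *+ 2 by rewrite /z -mulr_natr divfK.
rewrite sin_mulr2n sE -mulr_natr.
have h1 : 1 / 2 <= cos c * cos z by rewrite -c4 expr2 ler_pM.
have -> : cos z * (cos c * z) * 2 = (cos c * cos z) * z * 2 by ring.
nra.
Qed.

Lemma cosD2pi_int {R : realType} (a : R) (k : int) :
  cos (a + pi *+ 2 * k%:~R) = cos a.
Proof.
case: k => n.
  by rewrite -pmulrn mulr_natr; exact: (periodicn (@cosD2pi R)).
rewrite NegzE mulrNz mulrN -pmulrn mulr_natr.
by rewrite -[in RHS](subrK (pi *+ 2 *+ n.+1) a) (periodicn (@cosD2pi R)).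
Qed.

Lemma sinD2pi_int {R : realType} (a : R) (k : int) :
  sin (a + pi *+ 2 * k%:~R) = sin a.
Proof.
case: k => n.
  by rewrite -pmulrn mulr_natr; exact: (periodicn (@sinD2pi R)).
rewrite NegzE mulrNz mulrN -pmulrn mulr_natr.
by rewrite -[in RHS](subrK (pi *+ 2 *+ n.+1) a) (periodicn (@sinD2pi R)).
Qed.

Lemma one_sub_cos2 {R : realType} (y : R) : 1 - cos (y *+ 2) = 2 * sin y ^+ 2.
Proof. by rewrite cos_mulr2n cos2sin2 -mulr_natr; ring. Qed.

Definition root_angle {R : realType} (N m : nat) : R :=
  (pi * m%:R / N%:R) *+ 2.

Lemma cos_root_angle_sym {R : realType} {N m : nat} : (m <= N)%N -> (0 < N)%N ->
  cos (root_angle N (N - m) : R) = cos (root_angle N m).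
Proof.
move=> mN N0; have -> : root_angle N (N - m) = - root_angle N m + pi *+ 2 :> R.
  rewrite /root_angle natrB // mulrBr mulrBl mulfK ?pnatr_eq0 -?lt0n //.
  by rewrite mulrnBl addrC.
by rewrite cosD2pi cosN.
Qed.

(** The reflection of [m] to [N - m] reduces to [m <= N / 2]. There [1 - cos] is
    [2 sin^2 (pi m / N)], and [sin (pi m / N) >= (pi / 2) (m / N) >= m / N]. *)
Lemma one_sub_cos_root_angle {R : realType} {N m : nat} : (m <= N)%N ->
  2 * (minn m (N - m))%:R ^+ 2 / N%:R ^+ 2 <= 1 - cos (root_angle N m : R).
Proof.
move=> mN; have [->|N0] := posnP N.
  by rewrite expr0n /= invr0 mulr0 subr_ge0 cos_le1.
have N0' : 0 < N%:R :> R by rewrite ltr0n.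
have base k : (k.*2 <= N)%N -> 2 * k%:R ^+ 2 / N%:R ^+ 2
    <= 1 - cos (root_angle N k : R).
  move=> kN; rewrite /root_angle one_sub_cos2 -mulrA; apply: ler_wpM2l => //.
  have k2 : k%:R * 2 <= N%:R :> R by rewrite -natrM ler_nat muln2.
  have p2 := pi_ge2 R.
  have h : k%:R / N%:R <= sin (pi * k%:R / N%:R : R).
    apply: le_trans (sin_ge_half _ _).
      have : k%:R / N%:R * 1 <= k%:R / N%:R * (pi / 2) :> R.
        by apply: ler_wpM2l; [rewrite divr_ge0 | lra].
      by rewrite mulr1 mulrA [_ * pi]mulrC [pi * (_ / _)]mulrA.
    rewrite !mulr_ge0 ?invr_ge0 ?pi_ge0 //=.
    rewrite ler_pdivrMr // -mulrA; apply: ler_wpM2l; first exact: pi_ge0.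
    by rewrite mulrC ler_pdivlMr.
  rewrite -expr_div_n ler_sqr ?nnegrE ?divr_ge0 //.
  by apply: le_trans h; rewrite divr_ge0.
rewrite /minn; case: ifP => h; first by apply: base; lia.
rewrite -(cos_root_angle_sym mN N0); apply: base; lia.
Qed.

(** The side [2t + 1] is odd, so the angle [pi] is never reached. This keeps the torus eigenvalues
    inside the range of the decay estimate. *)
Lemma cos_root_angle_gtN1 {R : realType} {t m : nat} : (m < t.*2.+1)%N ->
  -1 < cos (root_angle t.*2.+1 m : R).
Proof.
move=> mN; have N0 : 0 < t.*2.+1%:R :> R by [].
have base k : (k <= t)%N -> -1 < cos (root_angle t.*2.+1 k : R).
  move=> kt; rewrite /root_angle cos_mulr2n -mulr_natr.
  have p0 := pi_gt0 R.
  have : 0 < cos (pi * k%:R / t.*2.+1%:R : R).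
    apply: cos_gt0_pihalf; apply/andP; split.
      apply: (@lt_le_trans _ _ 0); first by rewrite oppr_lt0; lra.
      by rewrite !mulr_ge0 ?invr_ge0 ?pi_ge0.
    rewrite ltr_pdivrMr // -mulrA ltr_pM2l // mulrC ltr_pdivlMr //.
    by rewrite -natrM ltr_nat; lia.
  by nra.
case: (leqP m t) => h; first exact: base.
by rewrite -cos_root_angle_sym //; [apply: base; lia | lia].
Qed.

Lemma cos_root_angle_lt1 {R : realType} {N m : nat} : (0 < m < N)%N ->
  cos (root_angle N m : R) < 1.
Proof.
move=> /andP[m0 mN]; rewrite -subr_gt0 one_sub_cos2 mulr_gt0 // exprn_gt0 //.
have N0 : 0 < N%:R :> R by rewrite ltr0n; lia.
apply: sin_gt0_pi; apply/andP; split.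
  by rewrite divr_gt0 // mulr_gt0 ?pi_gt0 ?ltr0n.
by rewrite ltr_pdivrMr // ltr_pM2l ?pi_gt0 // ltr_nat.
Qed.

(** The argument of the character of frequency [m] at the integer point [j]. Characters are handled
    through their real and imaginary parts, and [j] ranges over all integer vectors, so no reduction
    modulo the side is involved. *)
Definition phase {R : realType} {d n : nat} (m : {ffun 'I_d -> 'I_n.+1})
    (j : 'I_d -> int) : R :=
  \sum_i root_angle n.+1 (m i) * (j i)%:~R.

Lemma phaseB {R : realType} {d n : nat} (m : {ffun 'I_d -> 'I_n.+1})
    (j k : 'I_d -> int) :
  phase m (fun i => j i - k i) = phase m j - phase m k :> R.
Proof.
by rewrite /phase -sumrB; apply: eq_bigr => i _; rewrite intrB mulrBr.
Qed.

Lemma root_angleE {R : realType} (N m : nat) :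
  root_angle N m = m%:R * root_angle N 1 :> R.
Proof.
by rewrite /root_angle mulr1 [RHS]mulrnAr [_ * (pi / _)]mulrA [m%:R * _]mulrC.
Qed.

Lemma root_angle_full {R : realType} (n : nat) :
  pi *+ 2 = n.+1%:R * root_angle n.+1 1 :> R.
Proof. by rewrite -root_angleE /root_angle mulfK // pnatr_eq0. Qed.

(** In the cyclic group ['I_n.+1] the element [ord_max] is [-1], and wrapping around at 0 adds one
    full turn. *)
Lemma root_angleS {R : realType} {n : nat} (m : 'I_n.+1) :
  exists k : int, root_angle n.+1 (m + ord_max : 'I_n.+1)%R
    = root_angle n.+1 m - root_angle n.+1 1 + pi *+ 2 * k%:~R :> R.
Proof.
rewrite (root_angle_full n) (root_angleE _ m) (root_angleE _ (m + ord_max)%R).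
move: (root_angle _ 1) => w /=.
have [m0|m0] := posnP m.
  exists 1; rewrite m0 add0n modn_small // mulr1z -natr1; ring.
exists 0; have -> : ((m + n) %% n.+1 = m.-1)%N.
  have -> : (m + n = m.-1 + n.+1)%N by lia.
  by rewrite modnDr modn_small //; have := ltn_ord m; lia.
by rewrite -[in RHS](prednK m0) -natr1 mulr0z; ring.
Qed.

Lemma sum_cos_phase0 {R : realType} {d n : nat} {j : 'I_d -> int} {i0 : 'I_d} :
  cos (root_angle n.+1 1 * (j i0)%:~R : R) != 1 ->
  \sum_(m : {ffun 'I_d -> 'I_n.+1}) cos (phase m j : R) = 0.
Proof.
set w := root_angle n.+1 1 * (j i0)%:~R => w1.
(* Translating the frequency rotates the pair of cosine and sine sums by [-w]. *)
pose e : {ffun 'I_d -> 'I_n.+1} := [ffun i => if i == i0 then ord_max else 0%R].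
have shift m : exists k : int,
    phase (m + e) j = phase m j - w + pi *+ 2 * k%:~R :> R.
  have [k hk] := root_angleS (R := R) (m i0).
  exists (k * j i0); rewrite /phase (bigD1 i0) // [in RHS](bigD1 i0) //=.
  rewrite ffunE [e i0]ffunE eqxx hk intrM mulrDl mulrBl -/w.
  rewrite (eq_bigr (fun i => root_angle n.+1 (m i) * (j i)%:~R)); last first.
    by move=> i ii0; rewrite ffunE [e i]ffunE (negbTE ii0) addr0.
  by rewrite mulrA; ring.
set C := \sum_m _; pose S := \sum_(m : {ffun 'I_d -> 'I_n.+1}) sin (phase m j : R).
have CE : C = C * cos w + S * sin w.
  rewrite {1}/C (reindex_inj (addIr e)) /= !mulr_suml -big_split /=.
  apply: eq_bigr => m _.
  by have [k ->] := shift m; rewrite cosD2pi_int cosB.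
have SE : S = S * cos w - C * sin w.
  rewrite {1}/S (reindex_inj (addIr e)) /= !mulr_suml -sumrB /=.
  apply: eq_bigr => m _.
  by have [k ->] := shift m; rewrite sinD2pi_int sinB.
(* The vector [(C, S)] is fixed by a rotation, and [(1 - c)^2 + s^2 = 2 (1 - c)] is the determinant
   of the resulting linear system. *)
have h : C * (2 * (1 - cos w)) = 0.
  have c2 := cos2Dsin2 w; move: (cos w) (sin w) CE SE c2 => c s CE SE c2.
  have e1 : C * (1 - c) = S * s by lra.
  have e2 : S * (1 - c) = - (C * s) by lra.
  have -> : C * (2 * (1 - c)) = C * (1 - c) * (1 - c) + C * s * s
    + C * (1 - (c ^+ 2 + s ^+ 2)) by ring.
  by rewrite e1 mulrAC e2 c2; ring.
move/eqP: h; rewrite mulf_eq0 => /orP[/eqP //|].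
by rewrite mulf_eq0 pnatr_eq0 /= subr_eq0 eq_sym (negbTE w1).
Qed.

(** Expanding the squares leaves [cos] of phase differences, which are orthogonal over the
    frequencies. Only differences of positions enter, so [pos] may center the box at the origin. *)
Lemma parseval {R : realType} {d n : nat} (h : {ffun 'I_d -> 'I_n.+1} -> R)
    (pos : 'I_n.+1 -> int) :
  (forall a b : 'I_n.+1, pos a - pos b = (a : nat)%:Z - (b : nat)%:Z) ->
  (n.+1 ^ d)%:R * \sum_k h k ^+ 2 =
  \sum_(m : {ffun 'I_d -> 'I_n.+1})
    ((\sum_k h k * cos (phase m (pos \o k))) ^+ 2
     + (\sum_k h k * sin (phase m (pos \o k))) ^+ 2).
Proof.
move=> posB.
have orth (k l : {ffun 'I_d -> 'I_n.+1}) :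
    \sum_(m : {ffun 'I_d -> 'I_n.+1})
      cos (phase m (pos \o k) - phase m (pos \o l) : R)
    = if k == l then (n.+1 ^ d)%:R else 0.
  case: eqVneq => [->|kl].
    under eq_bigr do rewrite subrr cos0.
    by rewrite sumr_const card_ffun !card_ord.
  have [i0 hi0] : exists i0, k i0 != l i0.
    apply/existsP; rewrite -negb_forall; apply: contraNN kl => /forallP kl.
    by apply/eqP/ffunP => i; exact/eqP.
  under eq_bigr do rewrite -phaseB.
  apply: (sum_cos_phase0 (i0 := i0)); rewrite /= posB.
  (* As the cosine is even, the difference may be taken as a natural number strictly between 0 and
     the side. *)
  wlog lt_lk : k l hi0 {kl} / (l i0 < k i0)%N.
    move=> hw; case: (ltngtP (l i0) (k i0)) => [|lt_kl|/val_inj eq_lk].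
    - exact: hw.
    - rewrite -opprB intrN mulrN cosN; apply: hw => //.
      by rewrite eq_sym.
    - by rewrite eq_lk eqxx in hi0.
  rewrite subzn ?(ltnW lt_lk) // -pmulrn.
  have -> : root_angle n.+1 1 * (k i0 - l i0)%:R
      = root_angle n.+1 (k i0 - l i0) :> R.
    by rewrite [RHS]root_angleE mulrC.
  by rewrite lt_eqF // cos_root_angle_lt1 //; have := ltn_ord (k i0); lia.
transitivity (\sum_k \sum_l h k * h l * (\sum_(m : {ffun 'I_d -> 'I_n.+1})
      cos (phase m (pos \o k) - phase m (pos \o l) : R))).
  rewrite mulr_sumr; apply: eq_bigr => k _.
  rewrite (bigD1 k) //= orth eqxx big1 ?addr0 => [|l lk].
    by rewrite mulrC expr2.
  by rewrite orth eq_sym (negbTE lk) mulr0.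
under eq_bigr do under eq_bigr do rewrite mulr_sumr.
under eq_bigr do rewrite exchange_big.
rewrite exchange_big /=; apply: eq_bigr => m _.
rewrite !expr2 !mulr_suml -big_split /=; apply: eq_bigr => k _.
rewrite !mulr_sumr -big_split /=; apply: eq_bigr => l _.
by rewrite cosB; ring.
Qed.

(** * The kernel of the iteration *)

Definition unit_step {d : nat} (p : 'I_d * bool) : grid d :=
  \row_j (if j == p.1 then (-1) ^+ p.2 else 0).

Lemma unit_step_inj (d : nat) : injective (@unit_step d).
Proof.
move=> [i s] [j r] /rowP/(_ i); rewrite !mxE /= eqxx.
by case: eqVneq => [<-|_]; case: s; case: r.
Qed.

Lemma int_sum_sqr_eq1 {d : nat} (u : grid d) :
  \sum_(i < d) u ord0 i ^+ 2 = 1 -> exists p, u = unit_step p.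
Proof.
move=> u1.
have [i ui] : exists i, u ord0 i != 0.
  apply/existsP; rewrite -negb_forall; apply/negP => /forallP u0.
  by move: u1; rewrite big1 // => i _; rewrite (eqP (u0 i)) expr0n.
have sq1 (z : int) : z != 0 -> 1 <= z ^+ 2.
  by move=> z0; rewrite -gtz0_ge1 exprn_even_gt0.
move: u1; rewrite (bigD1 i) //= => u1.
have s0 : 0 <= \sum_(j < d | j != i) u ord0 j ^+ 2.
  by apply: sumr_ge0 => j _; exact: sqr_ge0.
have hi := sq1 _ ui.
have split1 (a b : int) : a + b = 1 -> 1 <= a -> 0 <= b -> a = 1 /\ b = 0 by lia.
have [ui1 sE] := split1 _ _ u1 hi s0.
have uj j : j != i -> u ord0 j = 0.
  move=> ji; move/eqP: sE.
  rewrite psumr_eq0 => [/allP/(_ j (mem_index_enum _))|k _]; last exact: sqr_ge0.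
  by rewrite ji /= sqrf_eq0 => /eqP.
exists (i, u ord0 i == -1); apply/rowP => j; rewrite mxE /=.
case: eqVneq => [->|/uj //].
by move/eqP: ui1; rewrite sqrf_eq1 => /orP[] /eqP ->.
Qed.

Lemma euclid_dist_eq1 {R : realType} {d : nat} (v w : grid d) :
  (euclid_dist R v w == 1) = (w \in [seq v + unit_step p | p : 'I_d * bool]).
Proof.
have -> : (euclid_dist R v w == 1) = (\sum_(i < d) (w - v) ord0 i ^+ 2 == 1).
  rewrite /euclid_dist -[eqbRHS]sqrtr1 eqr_sqrt //; last first.
    by apply: sumr_ge0 => i _; exact: sqr_ge0.
  rewrite -(eqr_int R) rmorph_sum /=; congr (_ == _); apply: eq_bigr => i _.
  by rewrite !mxE rmorphXn /= -[LHS]sqrrN -mulrNz opprB.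
apply/eqP/mapP => [/int_sum_sqr_eq1[p hp]|[p _ ->]].
  by exists p; rewrite ?mem_enum // -hp addrC subrK.
rewrite (addrC v) addrK (bigD1 p.1) //= big1 => [|i ip].
  by rewrite mxE eqxx addr0 sqrr_sign.
by rewrite mxE (negbTE ip) expr0n.
Qed.

Lemma mxact_grid_gossip {R : realType} {d : nat} (f : grid d -> R) (v : grid d) :
  mxact (@grid_gossip R d) f v
  = (2 * d%:R)^-1 * \sum_(p : 'I_d * bool) f (v + unit_step p).
Proof.
rewrite /mxact (fsbigE [seq v + unit_step p | p : 'I_d * bool]) //=.
- rewrite big_image_cond mulr_sumr /= [LHS]big_mkcond /=.
  apply: eq_bigr => p _; rewrite in_setT /= /grid_gossip /grid_adjacency.
  by rewrite euclid_dist_eq1 (fintype.image_f (fun q => v + unit_step q)) // mul1r.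
- rewrite map_inj_uniq ?enum_uniq // => p q /addrI; exact: unit_step_inj.
- move=> w _ hw; rewrite /grid_gossip /grid_adjacency euclid_dist_eq1.
  by rewrite (negbTE hw) !mul0r.
Qed.

(** A list of weighted displacements, repetitions allowed, turns sums into concatenations. Averaging
    over neighbors enlarges displacements by at most 1 per coordinate. The list depends neither on
    [f] nor on [v]. *)
Lemma jacobi_iter_local {R : realType} {d : nat} (D : R) (t : nat) :
  exists s : seq (R * grid d),
    (forall p, p \in s -> forall i, `|p.2 ord0 i| <= t%:Z) /\
    (forall f v, jacobi_iter (@grid_gossip R d) D f t v
       = \sum_(p <- s) p.1 * f (v + p.2)).
Proof.
pose scale (c : R) (s : seq (R * grid d)) := [seq (c * p.1, p.2) | p <- s].
pose avg (s : seq (R * grid d)) :=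
  [seq ((2 * d%:R)^-1 * p.1, q + p.2)
     | q <- [seq unit_step q | q : 'I_d * bool], p <- s].
have scaleE c s f v : \sum_(p <- scale c s) p.1 * f (v + p.2)
    = c * \sum_(p <- s) p.1 * f (v + p.2).
  by rewrite big_map mulr_sumr; apply: eq_bigr => p _; rewrite mulrA.
have avgE s f v : \sum_(p <- avg s) p.1 * f (v + p.2)
    = mxact (@grid_gossip R d) (fun w => \sum_(p <- s) p.1 * f (w + p.2)) v.
  rewrite mxact_grid_gossip big_allpairs_dep big_image /= mulr_sumr.
  apply: eq_bigr => q _; rewrite mulr_sumr; apply: eq_bigr => p _.
  by rewrite mulrA addrA.
pose bounded (n : nat) (s : seq (R * grid d)) :=
  forall p, p \in s -> forall i, `|p.2 ord0 i| <= n%:Z.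
have bscale n c s : bounded n s -> bounded n (scale c s).
  by move=> bs _ /mapP[p ps ->] i; exact: (bs p ps i).
have bS n s : bounded n s -> bounded n.+1 s.
  by move=> bs p ps i; apply: le_trans (bs p ps i) _; rewrite lez_nat leqnSn.
have bavg n s : bounded n s -> bounded n.+1 (avg s).
  move=> bs _ /allpairsPdep[q [p [/mapP[r _ ->] ps ->]]] i /=.
  rewrite !mxE -(addn1 n) PoszD addrC.
  apply: le_trans (ler_normD _ _) _; apply: lerD; first exact: bs.
  by case: ifP => _; rewrite ?normr0 ?normrX ?normrN1 ?expr1n.
have bcat n s r : bounded n s -> bounded n r -> bounded n (s ++ r).
  by move=> bs br p; rewrite mem_cat => /orP[/bs|/br].
pose repr t s := bounded t s /\ forall f v,
  jacobi_iter (@grid_gossip R d) D f t v = \sum_(p <- s) p.1 * f (v + p.2).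
(* The recurrence looks back two steps, so the induction carries two consecutive times. *)
suff [h _] : (exists s, repr t s) /\ (exists s, repr t.+1 s) by exact: h.
have r0 : repr 0 [:: (1, 0)].
  split=> [p|f v]; last by rewrite big_seq1 /= mul1r addr0.
  by rewrite inE => /eqP -> i; rewrite mxE.
elim: t => [|t [[s [bs hs]] [r [br hr]]]].
  split; first by exists [:: (1, 0)].
  exists (scale (jacobi_a D 0) (avg [:: (1, 0)])
          ++ scale (jacobi_b D 0) [:: (1, 0)]); split.
    by apply: bcat; apply: bscale; [apply: bavg | apply: bS]; exact: r0.1.
  move=> f v; rewrite big_cat !scaleE avgE -(r0.2 f v).
  by under [in RHS]eq_fun do rewrite big_seq1 /= mul1r addr0.
split; first by exists r.
exists (scale (jacobi_a D t.+1) (avg r) ++ (scale (jacobi_b D t.+1) r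
        ++ scale (- jacobi_c D t.+1) s)); split.
  apply: (bcat); first by apply: bscale; apply: bavg.
  apply: bcat; apply: (bscale); first exact: bS.
  by apply: (bS); exact: bS.
move=> f v; rewrite !big_cat !scaleE avgE -hr -hs.
have -> : (fun w => \sum_(p <- r) p.1 * f (w + p.2))
    = jacobi_iter (@grid_gossip R d) D f t.+1 by apply/funext => w; rewrite hr.
by rewrite /= mulNr addrA.
Qed.

(** The box [[-t, t]^d], indexed by the same type as the frequencies of the torus of side
    [2t + 1]. *)
Definition box_point {d : nat} (t : nat) (k : {ffun 'I_d -> 'I_t.*2.+1}) :
  grid d := \row_i ((k i : nat)%:Z - t%:Z).

Lemma box_point_inj {d t : nat} : injective (@box_point d t).
Proof.
move=> k l /rowP kl; apply/ffunP => i; apply/val_inj => /=.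
by have := kl i; rewrite !mxE => /addIr [].
Qed.

Lemma box_point_onto {d t : nat} {u : grid d} :
  (forall i, `|u ord0 i| <= t%:Z) -> exists k, u = @box_point d t k.
Proof.
move=> ut.
exists [ffun i => inord (absz (u ord0 i + t%:Z))]; apply/rowP => i.
rewrite mxE ffunE; have := ut i; move: (u ord0 i) => z zt.
by rewrite inordK; lia.
Qed.

Lemma jacobi_iter_kernel {R : realType} {d : nat} (D : R) (t : nat) :
  exists h : {ffun 'I_d -> 'I_t.*2.+1} -> R, forall f v,
    jacobi_iter (@grid_gossip R d) D f t v
    = \sum_k h k * f (v + box_point t k).
Proof.
have [s [bs hs]] := jacobi_iter_local (d := d) D t.
exists (fun k => \sum_(p <- s | p.2 == box_point t k) p.1) => f v.
rewrite hs; under [in RHS]eq_bigr do rewrite mulr_suml.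
rewrite (exchange_big_dep predT) //= big_seq [RHS]big_seq.
apply: eq_bigr => p ps; have [k pk] := box_point_onto (bs p ps).
rewrite (bigD1 k) ?pk //= -pk big1 ?addr0 // => l /andP[/eqP].
by rewrite pk => /box_point_inj ->; rewrite eqxx.
Qed.

(** * Fourier transform of the kernel *)

Lemma jacobi_iter_eigen {R : realType} {d : nat} {D x : R} {f : grid d -> R} :
  (forall v, mxact (@grid_gossip R d) f v = x * f v) ->
  forall t v, jacobi_iter (@grid_gossip R d) D f t v = jacobi_value D x t * f v.
Proof.
move=> fx t; have mxactZ (c : R) v :
    mxact (@grid_gossip R d) (fun w => c * f w) v = c * (x * f v).
  rewrite -fx !mxact_grid_gossip -mulr_sumr; ring.
suff [] : (forall v, jacobi_iter (@grid_gossip R d) D f t v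
      = jacobi_value D x t * f v) /\
    (forall v, jacobi_iter (@grid_gossip R d) D f t.+1 v
      = jacobi_value D x t.+1 * f v) by [].
elim: t => [|t [IH0 IH1]]; split=> // v.
- by rewrite /= mul1r.
- by rewrite /= fx; ring.
have -> : jacobi_iter (@grid_gossip R d) D f t.+2 v
    = jacobi_a D t.+1 * mxact (@grid_gossip R d)
        (jacobi_iter (@grid_gossip R d) D f t.+1) v
      + jacobi_b D t.+1 * jacobi_iter (@grid_gossip R d) D f t.+1 v
      - jacobi_c D t.+1 * jacobi_iter (@grid_gossip R d) D f t v by [].
rewrite IH0 IH1; have /funext -> := IH1; rewrite mxactZ.
have -> : jacobi_value D x t.+2
    = (jacobi_a D t.+1 * x + jacobi_b D t.+1) * jacobi_value D x t.+1
      - jacobi_c D t.+1 * jacobi_value D x t by [].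
by ring.
Qed.

Definition torus_eigenvalue {R : realType} {d n : nat}
    (m : {ffun 'I_d -> 'I_n.+1}) : R :=
  d%:R^-1 * \sum_i cos (root_angle n.+1 (m i)).

Lemma phase_step {R : realType} {d n : nat} (m : {ffun 'I_d -> 'I_n.+1})
    (v : grid d) (p : 'I_d * bool) :
  phase m (fun i => (v + unit_step p) ord0 i)
  = phase m (fun i => v ord0 i) + (-1) ^+ p.2 * root_angle n.+1 (m p.1) :> R.
Proof.
rewrite /phase (bigD1 p.1) // [in RHS](bigD1 p.1) //= !mxE eqxx.
rewrite rmorphD rmorph_sign /= mulrDr [_ * (-1) ^+ _]mulrC.
rewrite (eq_bigr (fun i => root_angle n.+1 (m i) * (v ord0 i)%:~R)); last first.
  by move=> i ip; rewrite !mxE (negbTE ip) addr0.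
by rewrite -!addrA; congr (_ + _); rewrite addrC.
Qed.

(** The two neighbors along an axis combine by [cos (a + b) + cos (a - b) = 2 cos a cos b]. *)
Lemma mxact_cos_phase {R : realType} {d n : nat} (m : {ffun 'I_d -> 'I_n.+1})
    (v : grid d) :
  mxact (@grid_gossip R d) (fun u => cos (phase m (fun i => u ord0 i))) v
  = torus_eigenvalue m * cos (phase m (fun i => v ord0 i)).
Proof.
rewrite mxact_grid_gossip /torus_eigenvalue.
under eq_bigr do rewrite phase_step.
rewrite -(pair_bigA _ (fun i (s : bool) => cos
  (phase m (fun i => v ord0 i) + (-1) ^+ s * root_angle n.+1 (m i)))) /=.
under eq_bigr do rewrite big_bool /= expr1 expr0 mulN1r mul1r cosD cosN sinN cosD.
transitivity ((2 * d%:R)^-1 * (2 * (cos (phase m (fun i => v ord0 i))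
    * \sum_i cos (root_angle n.+1 (m i) : R)))).
  by congr (_ * _); rewrite !mulr_sumr; apply: eq_bigr => i _; ring.
by rewrite invfM; move: (d%:R^-1) => e; field.
Qed.

Lemma mxact_sin_phase {R : realType} {d n : nat} (m : {ffun 'I_d -> 'I_n.+1})
    (v : grid d) :
  mxact (@grid_gossip R d) (fun u => sin (phase m (fun i => u ord0 i))) v
  = torus_eigenvalue m * sin (phase m (fun i => v ord0 i)).
Proof.
rewrite mxact_grid_gossip /torus_eigenvalue.
under eq_bigr do rewrite phase_step.
rewrite -(pair_bigA _ (fun i (s : bool) => sin
  (phase m (fun i => v ord0 i) + (-1) ^+ s * root_angle n.+1 (m i)))) /=.
under eq_bigr do rewrite big_bool /= expr1 expr0 mulN1r mul1r sinD cosN sinN sinD.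
transitivity ((2 * d%:R)^-1 * (2 * (sin (phase m (fun i => v ord0 i))
    * \sum_i cos (root_angle n.+1 (m i) : R)))).
  by congr (_ * _); rewrite !mulr_sumr; apply: eq_bigr => i _; ring.
by rewrite invfM; move: (d%:R^-1) => e; field.
Qed.

(** Applying the kernel to the characters and evaluating at the origin identifies its Fourier
    transform at [m] as [jacobi_value] at the eigenvalue, the sine part vanishing. Parseval then
    applies, as the box has exactly one point per residue class. *)
Lemma kernel_sqr_sum {R : realType} {d t : nat} {D : R}
    {h : {ffun 'I_d -> 'I_t.*2.+1} -> R} :
  (forall f v, jacobi_iter (@grid_gossip R d) D f t v
    = \sum_k h k * f (v + box_point t k)) ->
  (t.*2.+1 ^ d)%:R * \sum_k h k ^+ 2
  = \sum_(m : {ffun 'I_d -> 'I_t.*2.+1})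
      jacobi_value D (torus_eigenvalue m) t ^+ 2.
Proof.
move=> hE; rewrite (parseval h (fun a => (a : nat)%:Z - t%:Z)); last first.
  by move=> a b; lia.
apply: eq_bigr => m _.
have phE (k : {ffun 'I_d -> 'I_t.*2.+1}) :
    phase m ((fun a : 'I_t.*2.+1 => (a : nat)%:Z - t%:Z) \o k)
    = phase m (fun i => (0 + box_point t k) ord0 i) :> R.
  by congr phase; apply/funext => i; rewrite add0r mxE.
have ph0 : phase m (fun i => (0 : grid d) ord0 i) = 0 :> R.
  by rewrite /phase big1 // => i _; rewrite mxE mulr0.
under eq_bigr do rewrite phE.
under [X in _ + X ^+ 2]eq_bigr do rewrite phE.
rewrite -(hE (fun u => cos (phase m (fun i => u ord0 i)))).
rewrite -(hE (fun u => sin (phase m (fun i => u ord0 i)))).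
rewrite (jacobi_iter_eigen (mxact_cos_phase m)).
rewrite (jacobi_iter_eigen (mxact_sin_phase m)).
by rewrite ph0 cos0 sin0 mulr0 mulr1 expr0n addr0.
Qed.

Lemma jacobi_value1 {R : realType} {D : R} (t : nat) :
  0 <= D -> jacobi_value D 1 t = 1.
Proof.
move=> D0.
suff [-> //] : jacobi_value D 1 t = 1 /\ jacobi_value D 1 t.+1 = 1.
elim: t => [|t [IH0 IH1]]; split=> //.
  by rewrite /= /jacobi_a /jacobi_b; field; rewrite gt_eqF //; lra.
have -> : jacobi_value D 1 t.+2
    = (jacobi_a D t.+1 * 1 + jacobi_b D t.+1) * jacobi_value D 1 t.+1
      - jacobi_c D t.+1 * jacobi_value D 1 t by [].
by rewrite IH0 IH1 jacobi_aE //; ring.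
Qed.

(** The constant function is an eigenvector with eigenvalue 1, and the polynomials are 1 there. *)
Lemma kernel_sum {R : realType} {d t : nat} {D : R}
    {h : {ffun 'I_d -> 'I_t.*2.+1} -> R} : (0 < d)%N -> 0 <= D ->
  (forall f v, jacobi_iter (@grid_gossip R d) D f t v
    = \sum_k h k * f (v + box_point t k)) ->
  \sum_k h k = 1.
Proof.
move=> d0 D0 hE.
have e1 v : mxact (@grid_gossip R d) (fun=> 1) v = 1 * 1.
  rewrite mxact_grid_gossip sumr_const card_prod card_ord card_bool mulr1.
  by rewrite natrM [_ * 2]mulrC mulVf // mulf_neq0 // pnatr_eq0 -lt0n.
have := hE (fun=> 1) 0; rewrite (jacobi_iter_eigen e1).
under [in RHS]eq_bigr do rewrite mulr1.
move=> <-; rewrite mulr1.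
exact: jacobi_value1.
Qed.

(** * Summing the decay estimate over the torus *)

Lemma harmonic_le_ln {R : realType} (n : nat) :
  \sum_(j < n.+1) (j.+1%:R)^-1 <= 1 + ln (n.+1%:R : R).
Proof.
elim: n => [|n IH]; first by rewrite big_ord_recr big_ord0 /= invr1 ln1; lra.
rewrite big_ord_recr /=.
have n2 : n.+2%:R != 0 :> R by rewrite pnatr_eq0.
have hV : (n.+2%:R : R)^-1 < 1 by rewrite invf_lt1 // ltr1n.
have : ln (1 + - (n.+2%:R : R)^-1) <= - (n.+2%:R)^-1.
  by apply: le_ln1Dx; rewrite ltrN2.
have -> : 1 + - (n.+2%:R : R)^-1 = n.+1%:R / n.+2%:R.
  by rewrite -[n.+1%:R](addrK 1) natr1 mulrBl divff // mul1r.
rewrite ln_div ?posrE // lerNr opprB => h.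
by apply: le_trans (lerD IH h) _; rewrite -addrA [ln _ + _]addrC subrK.
Qed.

(** Distance to 0 in the cyclic group of order [N], raised to at least 1 so that it can be
    inverted. *)
Definition cyclic_dist (N a : nat) : nat := maxn 1 (minn a (N - a)).

(** For [a > 0], [1 / min (a, N - a) <= 1 / a + 1 / (N - a)]. Writing [1 / a] as [1 / (a + 1)] plus
    a telescoping difference leaves two full harmonic sums and a remainder of at most 2. *)
Lemma sum_inv_cyclic_dist {R : realType} (n : nat) :
  \sum_(a < n.+1) ((cyclic_dist n.+1 a)%:R : R)^-1
    <= 4 + 2 * ln (n.+1%:R : R).
Proof.
have h (a : 'I_n.+1) : ((cyclic_dist n.+1 a)%:R : R)^-1
    <= (a.+1%:R)^-1 + ((rev_ord a).+1%:R)^-1 + (if a == ord0 then 1 else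
       (a%:R)^-1 - (a.+1%:R)^-1).
  have aN := ltn_ord a; rewrite /= /cyclic_dist.
  have p1 : 0 <= (a.+1%:R : R)^-1 by rewrite invr_ge0.
  have p2 : 0 <= ((n.+1 - a.+1).+1%:R : R)^-1 by rewrite invr_ge0.
  case: eqVneq => [a0|a0].
    have -> : maxn 1 (minn a (n.+1 - a)) = 1%N by rewrite a0 min0n.
    by rewrite invr1 lerDr addr_ge0.
  have a1 : (0 < a)%N by rewrite lt0n.
  have p3 : 0 <= (a%:R : R)^-1 by rewrite invr_ge0.
  have -> : (n.+1 - a.+1).+1 = (n.+1 - a)%N by lia.
  have -> : maxn 1 (minn a (n.+1 - a)) = minn a (n.+1 - a) by lia.
  have p4 : 0 <= ((n.+1 - a)%:R : R)^-1 by rewrite invr_ge0.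
  have -> (x y z : R) : y + z + (x - y) = x + z by ring.
  by rewrite /minn; case: ifP => _; rewrite ?lerDl ?lerDr.
apply: le_trans (ler_sum _ (fun a _ => h a)) _.
rewrite !big_split /=.
have -> : \sum_(a < n.+1) (((rev_ord a).+1)%:R : R)^-1
    = \sum_(a < n.+1) ((a.+1)%:R)^-1.
  by rewrite [RHS](reindex_inj rev_ord_inj).
have tel : \sum_(a < n.+1) (if a == ord0 then 1 else
       (a%:R : R)^-1 - (a.+1%:R)^-1) <= 2.
  rewrite big_ord_recl eqxx /=.
  suff : \sum_(i < n) (if lift ord0 i == ord0 then 1 else
      ((bump 0 i)%:R : R)^-1 - ((bump 0 i).+1%:R)^-1) = 1 - (n.+1%:R)^-1.
    move=> ->; have : 0 <= (n.+1%:R : R)^-1 by rewrite invr_ge0.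
    by move: (_^-1) => y; lra.
  transitivity (\sum_(i < n) ((i.+1%:R : R)^-1 - (i.+2%:R)^-1)).
    by apply: eq_bigr => i _.
  elim: n {h} => [|n IH]; first by rewrite big_ord0 invr1 subrr.
  by rewrite big_ord_recr IH /= addrA subrK.
have H := harmonic_le_ln (R := R) n; move: (ln _) H => l H.
have -> : 4 + 2 * l = 1 + l + (1 + l) + 2 by ring.
by apply: lerD => //; exact: lerD.
Qed.

Lemma torus_eigenvalue_bounds {R : realType} {d t : nat}
    {m : {ffun 'I_d -> 'I_t.*2.+1}} {i0 : 'I_d} : m i0 != ord0 ->
  -1 < (torus_eigenvalue m : R) < 1.
Proof.
move=> mi0; have d0 : (0 < d)%N by apply: leq_ltn_trans (ltn_ord i0).
have d0' : 0 < d%:R :> R by rewrite ltr0n.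
have cst (c : R) : c = d%:R^-1 * \sum_(i < d) c.
  by rewrite sumr_const card_ord -[X in _ * X]mulr_natl mulrA mulVf ?mul1r //
     gt_eqF.
rewrite /torus_eigenvalue [X in X < _ < _]cst [X in _ < _ < X]cst.
rewrite !ltr_pM2l ?invr_gt0 //; apply/andP; split.
  apply: ltr_sum => [|i _]; first by apply/hasP; exists i0; rewrite ?mem_index_enum.
  exact: cos_root_angle_gtN1.
rewrite (bigD1 i0) //= [ltRHS](bigD1 i0) //=; apply: ltr_leD.
  by apply: cos_root_angle_lt1; rewrite ltn_ord andbT lt0n.
by apply: ler_sum => i _; exact: cos_le1.
Qed.

(** All terms of [1 - x = (1 / d) sum_j (1 - cos)] are nonnegative, so the [i]-th alone bounds the
    sum from below. *)
Lemma torus_eigenvalue_gap {R : realType} {d t : nat}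
    (m : {ffun 'I_d -> 'I_t.*2.+1}) (i : 'I_d) :
  (minn (m i) (t.*2.+1 - m i))%:R
    <= d%:R * t.*2.+1%:R * Num.sqrt (1 - torus_eigenvalue m) :> R.
Proof.
have d0 : (0 < d)%N by apply: leq_ltn_trans (ltn_ord i).
have d1 : 1 <= d%:R :> R by rewrite ler1n.
have N0 : 0 < t.*2.+1%:R :> R by [].
set u : R := (minn _ _)%:R; set N : R := t.*2.+1%:R.
have -> : 1 - torus_eigenvalue m
    = d%:R^-1 * \sum_j (1 - cos (root_angle t.*2.+1 (m j))) :> R.
  rewrite sumrB sumr_const card_ord mulrBr mulVf //.
  by rewrite pnatr_eq0 -lt0n.
have h1 : 2 * u ^+ 2 / N ^+ 2
    <= \sum_j (1 - cos (root_angle t.*2.+1 (m j))) :> R.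
  apply: (le_trans (one_sub_cos_root_angle (ltnW (ltn_ord (m i))))).
  rewrite (bigD1 i) //= lerDl; apply: sumr_ge0 => j _.
  by rewrite subr_ge0 cos_le1.
move: (\sum_j _) h1 => S h1.
have u0 : 0 <= u by [].
have uN : 0 <= d%:R * N by rewrite mulr_ge0.
have S0 : 0 <= S by apply: le_trans h1; rewrite divr_ge0 ?mulr_ge0 ?sqr_ge0.
rewrite -[leLHS]ger0_norm // -sqrtr_sqr -[d%:R * N]ger0_norm // -sqrtr_sqr.
rewrite -sqrtrM ?sqr_ge0 //; apply: ler_wsqrtr.
have -> : (d%:R * N) ^+ 2 * (d%:R^-1 * S) = d%:R * (S * N ^+ 2).
  by field; rewrite gt_eqF //; lra.
rewrite ler_pdivrMr ?exprn_gt0 // in h1.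
move: (S * _) h1 => w h1; have := sqr_ge0 u; move: (u ^+ 2) h1 => v h1 v0.
by nra.
Qed.

Lemma torus_sum_bound (R : realType) (d : nat) : (0 < d)%N ->
  exists2 C : R, 0 < C & forall t, (0 < t)%N ->
    \sum_(m : {ffun 'I_d -> 'I_t.*2.+1})
      jacobi_value d%:R (torus_eigenvalue m) t ^+ 2
      <= C * (4 + 2 * ln (t.*2.+1%:R : R)) ^+ d.
Proof.
move=> d0; have [C C0 hC] := jacobi_value_decay R d.
set K : R := (3 * d%:R) ^+ d * C.
have K0 : 0 <= K by rewrite mulr_ge0 ?exprn_ge0 ?mulr_ge0 // ltW.
(* The summand 1 covers the zero frequency, where the eigenvalue is 1, and [K] covers the others. *)
exists (1 + K); first by lra.
move=> t t0; set N := t.*2.+1.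
have pt (m : {ffun 'I_d -> 'I_N}) :
    jacobi_value d%:R (torus_eigenvalue m) t ^+ 2
    <= (1 + K) * \prod_i ((cyclic_dist N (m i))%:R : R)^-1.
  have P0 : 0 < \prod_i ((cyclic_dist N (m i))%:R : R).
    by apply: prodr_gt0 => i _; rewrite ltr0n leq_max.
  rewrite prodfV ler_pdivlMr //.
  case: (pselect (exists i, m i != ord0)) => [[i0 mi0]|m0]; last first.
    have m0' i : m i = ord0.
      by apply/eqP/negPn/negP => mi; apply: m0; exists i.
    have -> : torus_eigenvalue m = 1 :> R.
      rewrite /torus_eigenvalue.
      under eq_bigr do rewrite m0' /root_angle mulr0 mul0r mul0rn cos0.
      by rewrite sumr_const card_ord mulVf // pnatr_eq0 -lt0n.
    rewrite jacobi_value1 // expr1n mul1r big1 ?lerDl // => i _.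
    by rewrite m0' /cyclic_dist min0n.
  have hx := torus_eigenvalue_bounds (R := R) mi0.
  set s := Num.sqrt (1 - torus_eigenvalue m : R).
  have dist i : (minn (m i) (N - m i))%:R <= 3 * d%:R * (t%:R * s) :> R.
    apply: le_trans (torus_eigenvalue_gap m i) _.
    rewrite -/s mulrA; apply: ler_wpM2r; first exact: sqrtr_ge0.
    by rewrite [3 * _]mulrC -mulrA ler_wpM2l // -natrM ler_nat; lia.
  (* If the distance was raised to 1, the bound comes from the coordinate [i0], whose own distance
     is at least 1. *)
  have dist1 i : (cyclic_dist N (m i))%:R <= 3 * d%:R * (t%:R * s) :> R.
    rewrite /cyclic_dist /maxn; case: ifP => _; first exact: dist.
    apply: le_trans (dist i0); rewrite ler1n.
    have := ltn_ord (m i0); have : (0 < m i0)%N by rewrite lt0n.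
    by rewrite /N; lia.
  (* Bounding the product instead of the [d]-th power of the maximum makes the
     sum over the torus factor into one-dimensional harmonic sums. *)
  have hP : \prod_i ((cyclic_dist N (m i))%:R : R)
      <= (3 * d%:R) ^+ d * (t%:R * s) ^+ d.
    rewrite -exprMn -[X in _ ^+ X](card_ord d) -prodr_const.
    by apply: ler_prod => i _; rewrite dist1 andbT.
  apply: le_trans (ler_wpM2l (sqr_ge0 _) hP) _.
  rewrite mulrCA; apply: (@le_trans _ _ K); last by lra.
  by apply: ler_wpM2l; [rewrite exprn_ge0 ?mulr_ge0 | exact: hC].
apply: le_trans (ler_sum _ (fun m _ => pt m)) _.
rewrite -mulr_sumr; apply: ler_wpM2l; first by lra.
rewrite -(bigA_distr_bigA (fun (i : 'I_d) (a : 'I_N) =>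
  ((cyclic_dist N a)%:R : R)^-1)) prodr_const card_ord.
have H := sum_inv_cyclic_dist (R := R) t.*2.
have S0 : 0 <= \sum_(a < N) ((cyclic_dist N a)%:R : R)^-1.
  by apply: sumr_ge0 => a _; rewrite invr_ge0.
by rewrite lerXn2r // nnegrE // (le_trans S0 H).
Qed.

(** * Second moments of independent variables *)

Lemma integral_law {disp : measure_display} {T : measurableType disp}
    {R : realType} {P : probability T R}
    {X : {RV P >-> measurableTypeR R}}
    {nu : probability (measurableTypeR R) R} {f : measurableTypeR R -> R} :
  (forall A, measurable A -> distribution P X A = nu A) ->
  nu.-integrable setT (EFin \o f) ->
  P.-integrable setT (EFin \o (f \o X)) /\
  (\int[P]_w (f (X w))%:E = \int[nu]_x (f x)%:E)%E.
Proof.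
move=> hX intf; have mf := measurable_int _ intf.
have mf' : measurable_fun setT f by exact/measurable_EFinP.
have intP : P.-integrable setT (EFin \o (f \o X)).
  apply/integrableP; split.
    apply/measurable_EFinP.
    exact: (measurableT_comp mf' (measurable_funPT X)).
  have /integrableP[_] := intf.
  rewrite (eq_measure_integral (distribution P X)); last first.
    by move=> A mA _; apply/esym; exact: hX.
  rewrite ge0_integral_distribution //.
  exact: measurableT_comp.
split=> //.
rewrite [RHS](eq_measure_integral (distribution P X)); last first.
  by move=> A mA _; apply/esym; exact: hX.
by rewrite integral_distribution.
Qed.

(** Independence says that the joint law agrees with the product law on rectangles, hence
    everywhere, and Fubini separates the integral. *)
Lemma integral_indep_mul {disp : measure_display} {T : measurableType disp}
    {R : realType} {P : probability T R}
    {X Y : {RV P >-> measurableTypeR R}} {f g : measurableTypeR R -> R} :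
  (forall A B : set (measurableTypeR R), measurable A -> measurable B ->
    P (X @^-1` A `&` Y @^-1` B) = P (X @^-1` A) * P (Y @^-1` B))%E ->
  measurable_fun setT f -> measurable_fun setT g ->
  P.-integrable setT (EFin \o (f \o X)) ->
  P.-integrable setT (EFin \o (g \o Y)) ->
  P.-integrable setT (fun w => (f (X w) * g (Y w))%:E) ->
  (\int[P]_w (f (X w) * g (Y w))%:E
   = \int[P]_w (f (X w))%:E * \int[P]_w (g (Y w))%:E)%E.
Proof.
move=> indep mf mg intf intg intfg.
pose h w := (X w, Y w).
have mh : measurable_fun setT h by apply: measurable_fun_pair.
pose H : {mfun T >-> (measurableTypeR R * measurableTypeR R)%type} :=
  HB.pack h (isMeasurableFun.Build _ _ _ _ h mh).
pose F (z : measurableTypeR R * measurableTypeR R) : \bar R :=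
  (f z.1 * g z.2)%:E.
have mF : measurable_fun setT F.
  apply/measurable_EFinP; apply: measurable_funM.
    exact: measurableT_comp mf measurable_fst.
  exact: measurableT_comp mg measurable_snd.
pose m1 := distribution P X; pose m2 := distribution P Y.
have prodE A : measurable A -> (m1 \x m2)%E A = distribution P H A.
  by apply: product_measure_unique => B C mB mC; exact: indep.
have intF : (m1 \x m2)%E.-integrable setT F.
  apply/integrableP; split => //.
  rewrite (eq_measure_integral (distribution P H)); last first.
    by move=> A mA _; exact: prodE.
  rewrite ge0_integral_distribution //; last exact: measurableT_comp.
  by have /integrableP[] := intfg.
have -> : (\int[P]_w (f (X w) * g (Y w))%:E = \int[distribution P H]_z F z)%E.
  by rewrite integral_distribution.
rewrite (eq_measure_integral (m1 \x m2)%E); last first.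
  by move=> A mA _; apply/esym; exact: prodE.
rewrite -integral12_prod_meas1 //.
have hm (Z : {RV P >-> measurableTypeR R}) (k : measurableTypeR R -> R) :
    measurable_fun setT k -> P.-integrable setT (EFin \o (k \o Z)) ->
    (distribution P Z).-integrable setT (EFin \o k) /\
    (\int[distribution P Z]_y (k y)%:E = \int[P]_w (k (Z w))%:E)%E.
  move=> mk intk; have mk' : measurable_fun setT (EFin \o k).
    exact/measurable_EFinP.
  split; last by rewrite integral_distribution.
  apply/integrableP; split => //.
  rewrite ge0_integral_distribution //; last exact: measurableT_comp.
  by have /integrableP[] := intk.
have [if1 ef1] := hm X f mf intf; have [ig2 eg2] := hm Y g mg intg.
have fin : (\int[P]_w (g (Y w))%:E)%E \is a fin_num.
  exact: (integrable_fin_num _ intg).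
transitivity (\int[m1]_x ((f x)%:E * \int[P]_w (g (Y w))%:E))%E.
  apply: eq_integral => x _.
  rewrite -eg2 -integralZl //.
by rewrite -(fineK fin) integralZr // ef1.
Qed.

Lemma variance_linear_comb {disp : measure_display} {T : measurableType disp}
    {R : realType} {P : probability T R} {K : finType}
    {Y : K -> T -> R} {s2 : R} :
  (forall k l, P.-integrable setT (fun w => (Y k w * Y l w)%:E)) ->
  (forall k l, \int[P]_w (Y k w * Y l w)%:E = (if k == l then s2 else 0)%:E)%E ->
  forall h : K -> R,
  (\int[P]_w ((\sum_k h k * Y k w) ^+ 2)%:E = (s2 * \sum_k h k ^+ 2)%:E)%E.
Proof.
move=> intY covY h.
transitivity (\int[P]_w \sum_k \sum_l ((h k * h l)%:E * (Y k w * Y l w)%:E))%E.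
  apply: eq_integral => w _.
  under [RHS]eq_bigr do under eq_bigr do rewrite -EFinM.
  under [RHS]eq_bigr do rewrite sumEFin.
  rewrite sumEFin; congr (_%:E); rewrite expr2 mulr_suml.
  apply: eq_bigr => k _; rewrite mulr_sumr; apply: eq_bigr => l _.
  by rewrite mulrACA.
have intYY k l : P.-integrable setT
    (fun w => (h k * h l)%:E * (Y k w * Y l w)%:E)%E by exact: integrableZl.
rewrite integral_sum //; last by move=> k; exact: integrable_sum.
under eq_bigr do rewrite integral_sum //.
under eq_bigr do under eq_bigr do rewrite integralZl // covY -EFinM.
under eq_bigr do rewrite sumEFin.
rewrite sumEFin; congr (_%:E); rewrite mulr_sumr; apply: eq_bigr => k _.
rewrite (bigD1 k) //= eqxx big1 => [|l lk].
  by rewrite addr0 mulrC expr2.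
by rewrite eq_sym (negbTE lk) mulr0.
Qed.

(** * The limit *)

Lemma near_ln_ge {R : realType} (a : R) : \forall t \near \oo, a <= ln (t%:R : R).
Proof.
near=> t; have h : expR a <= t%:R by near: t; exact: nbhs_infty_ger.
by rewrite -[a]expRK ler_ln ?posrE ?expR_gt0 // (lt_le_trans _ h) ?expR_gt0.
Unshelve. all: by end_near. Qed.

(** [ln (e t) + d ln t] lies between [-A] and [A + 8 d sqrt (ln t)], so after division by [ln t] the
    error is at most [K / sqrt (ln t)]. *)
Lemma ln_ratio_cvg {R : realType} (d : nat) (s C : R) (e : nat -> R) :
  0 < s -> 0 < C ->
  (forall t, (0 < t)%N -> s / t.*2.+1%:R ^+ d <= e t
    <= C * (4 + 2 * ln (t.*2.+1%:R : R)) ^+ d / t.*2.+1%:R ^+ d) ->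
  (fun t : nat => ln (e t) / ln (t%:R : R)) @ \oo --> - (d%:R : R).
Proof.
move=> s0 C0 he.
set A : R := `|ln s| + `|ln C| + 3 * d%:R; set K : R := A + 8 * d%:R.
have A0 : 0 <= A by rewrite !addr_ge0 ?mulr_ge0.
have K0 : 0 <= K by rewrite addr_ge0 ?mulr_ge0.
apply/cvgrPdist_le => eps eps0; near=> t.
have t0 : (0 < t)%N by near: t; exact: nbhs_infty_gt.
have L1 : 1 <= ln (t%:R : R) by near: t; exact: near_ln_ge.
have Leps : (K / eps) ^+ 2 <= ln (t%:R : R) by near: t; exact: near_ln_ge.
have tp : 0 < t%:R :> R by rewrite ltr0n.
have Np : 0 < t.*2.+1%:R :> R by [].
have tN : t%:R <= t.*2.+1%:R :> R by rewrite ler_nat; lia.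
have Nt : t.*2.+1%:R <= 3 * t%:R :> R by rewrite -natrM ler_nat; lia.
have l1 : ln (t%:R : R) <= ln (t.*2.+1%:R : R) by rewrite ler_ln ?posrE.
have l2 : ln (t.*2.+1%:R : R) <= 3 + ln (t%:R : R).
  apply: (@le_trans _ _ (ln (3 * t%:R : R))).
    by rewrite ler_ln ?posrE // mulr_gt0.
  by rewrite lnM ?posrE // lerD2r ltW // ln_sublinear.
have /andP[e1 e2] := he t t0.
have e0 : 0 < e t by apply: lt_le_trans e1; rewrite divr_gt0 ?exprn_gt0.
move: (ln (t%:R : R)) L1 Leps l1 l2 => L L1 Leps l1 l2.
have lnN : ln (t.*2.+1%:R ^+ d : R) = d%:R * ln (t.*2.+1%:R : R).
  by rewrite lnXn // mulr_natl.
have low : ln s - d%:R * ln (t.*2.+1%:R : R) <= ln (e t).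
  rewrite -lnN -ln_div ?posrE ?exprn_gt0 // ler_ln ?posrE //.
  by rewrite divr_gt0 ?exprn_gt0.
have Q0 : 0 < 4 + 2 * ln (t.*2.+1%:R : R) by lra.
have upp : ln (e t) <= ln C + d%:R * ln (4 + 2 * ln (t.*2.+1%:R : R))
     - d%:R * ln (t.*2.+1%:R : R).
  rewrite -lnN.
  have -> : d%:R * ln (4 + 2 * ln (t.*2.+1%:R : R))
      = ln ((4 + 2 * ln (t.*2.+1%:R : R)) ^+ d) by rewrite lnXn // mulr_natl.
  rewrite -lnM ?posrE ?exprn_gt0 // -ln_div ?posrE ?exprn_gt0 ?mulr_gt0 ?exprn_gt0 //.
  by rewrite ler_ln ?posrE // divr_gt0 ?mulr_gt0 ?exprn_gt0.
set r := Num.sqrt L.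
have r2 : r ^+ 2 = L by rewrite sqr_sqrtr //; lra.
have r1 : 1 <= r by rewrite -sqrtr1 ler_wsqrtr.
(* Since [ln (2t + 1) <= 3 + r^2] and [r >= 1], the argument is at most [(4 r)^2], and
   [ln (4 r) < 4 r]. *)
have lnQ : ln (4 + 2 * ln (t.*2.+1%:R : R)) <= 8 * r.
  apply: (@le_trans _ _ (ln ((4 * r) ^+ 2))).
    by rewrite ler_ln ?posrE ?exprn_gt0 ?exprMn ?r2 //; lra.
  rewrite lnXn; last by lra.
  have : ln (4 * r) < 4 * r by apply: ln_sublinear; lra.
  by rewrite -mulr_natr; lra.
have Kr : K / eps <= r.
  rewrite -[leLHS]ger0_norm ?divr_ge0 ?(ltW eps0) // -sqrtr_sqr.
  exact: ler_wsqrtr.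
rewrite ler_pdivrMr // in Kr.
have d0 : 0 <= d%:R :> R by [].
have dl1 := ler_wpM2l d0 l1; have dl2 := ler_wpM2l d0 l2.
have dQ := ler_wpM2l d0 lnQ.
have : - A <= ln (e t) + d%:R * L <= A + 8 * d%:R * r.
  have := ler_norm (- ln s); have := ler_norm (ln C); rewrite normrN.
  have := normr_ge0 (ln s); have := normr_ge0 (ln C).
  by rewrite /A; lra.
move=> /andP[b1 b2].
have L0 : 0 < L by lra.
have -> : - d%:R - ln (e t) / L = - ((ln (e t) + d%:R * L) / L).
  by field; rewrite gt_eqF.
rewrite normrN normrM normfV (gtr0_norm L0) ler_pdivrMr //.
apply: (@le_trans _ _ (K * r)); last first.
  by rewrite -r2 expr2 mulrA [eps * r]mulrC; apply: ler_wpM2r; lra.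
have hA : A <= A * r by rewrite ler_peMr.
have hd : 0 <= 8 * d%:R * r by rewrite !mulr_ge0 //; lra.
by rewrite ler_norml /K mulrDl; lra.
Unshelve. all: by end_near. Qed.

(** Cauchy-Schwarz, obtained by expanding the squared deviations of [h] from its mean [1 / |K|]. *)
Lemma kernel_sqr_sum_ge {R : realType} {K : finType} (h : K -> R) :
  \sum_k h k = 1 -> (#|K|%:R)^-1 <= \sum_k h k ^+ 2.
Proof.
move=> h1; have [K0|K0] := posnP #|K|.
  by rewrite K0 invr0; apply: sumr_ge0 => k _; exact: sqr_ge0.
have M0 : #|K|%:R != 0 :> R by rewrite pnatr_eq0 -lt0n.
have : 0 <= \sum_k (h k - (#|K|%:R)^-1) ^+ 2.
  by apply: sumr_ge0 => k _; exact: sqr_ge0.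
under eq_bigr do rewrite sqrrB.
rewrite big_split sumrB /= sumrMnl -mulr_suml h1 sumr_const -[_ ^+ 2 *+ _]mulr_natl.
have -> : #|K|%:R * (#|K|%:R)^-1 ^+ 2 = (#|K|%:R)^-1 :> R.
  by rewrite expr2 mulrA divff // mul1r.
by rewrite mul1r -mulr_natr; move: (_^-1) (\sum_k _) => x y; lra.
Qed.

(** As the weights sum to 1, the error is a combination of the centered samples. Distinct indices
    give distinct vertices, so the covariances off the diagonal vanish. *)
Lemma expectation_sqr_kernel {R : realType} {d : nat}
    {nu : probability (measurableTypeR R) R} {mu : R}
    {disp : measure_display} {T : measurableType disp} {P : probability T R}
    {xi : grid d -> {RV P >-> measurableTypeR R}} :
  'E_nu[idfun]%E = mu%:E -> 'V_nu[idfun]%E \is a fin_num ->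
  iid_samples xi nu ->
  forall (v : grid d) (t : nat) (h : {ffun 'I_d -> 'I_t.*2.+1} -> R),
  \sum_k h k = 1 ->
  'E_P[fun w : T =>
     ((\sum_k h k * xi (v + box_point t k) w - mu) ^+ 2)%R]%E
  = (fine 'V_nu[idfun]%E * \sum_k h k ^+ 2)%:E.
Proof.
move=> nu_mean nu_fin [indep law] v t h h1.
pose c (x : measurableTypeR R) : R := x - mu.
have mc : measurable_fun setT c by apply: measurable_funB.
have VE : 'V_nu[idfun]%E = (\int[nu]_x (c x * c x)%:E)%E.
  by rewrite /variance covariance.unlock nu_mean /= expectation.unlock.
have intcc : nu.-integrable setT (EFin \o (fun x => c x * c x)).
  apply/integrableP; split.
    by apply/measurable_EFinP; exact: measurable_funM.
  rewrite (eq_integral (fun x => (c x * c x)%:E)) => [|x _]; last first.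
    by rewrite /= ger0_norm // -expr2 sqr_ge0.
  by rewrite -VE ltey_eq nu_fin.
have int1 (k : R) : nu.-integrable setT (EFin \o (cst k : measurableTypeR R -> R)).
  exact: finite_measure_integrable_cst.
(* The first moment is dominated through [|c| <= 1 + c^2]. *)
have intc : nu.-integrable setT (EFin \o c).
  apply: (@le_integrable _ _ _ _ _ measurableT _
    (fun x => (1 + c x * c x)%:E)).
  - exact/measurable_EFinP.
  - move=> x _ /=; rewrite lee_fin.
    rewrite [leRHS]ger0_norm; last by rewrite addr_ge0 // -expr2 sqr_ge0.
    by rewrite ler_norml; apply/andP; split; nra.
  - exact: (integrableD measurableT (int1 1) intcc).
have intid : nu.-integrable setT (EFin \o (fun x : measurableTypeR R => x : R)).
  have -> : EFin \o (fun x : measurableTypeR R => x : R)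
      = ((EFin \o c) \+ (EFin \o cst mu))%E.
    by apply/funext => x /=; rewrite -EFinD /c subrK.
  exact: integrableD.
have meanc : (\int[nu]_x (c x)%:E = 0)%E.
  under eq_integral do rewrite EFinB.
  rewrite integralB_EFin //; last exact: (int1 mu).
  rewrite integral_cst //= probability_setT mule1.
  by move: nu_mean; rewrite unlock => ->; rewrite subee.
pose X k := xi (v + box_point t k).
have lawc k := integral_law (law (v + box_point t k)) intc.
have lawcc k := integral_law (law (v + box_point t k)) intcc.
have mcX k : measurable_fun setT (fun w => c (X k w)).
  exact: (measurableT_comp mc (measurable_funPT (X k))).
have intXX k l : P.-integrable setT (fun w => (c (X k w) * c (X l w))%:E).
  apply: (@le_integrable _ _ _ _ _ measurableT _
    (fun w => (c (X k w) * c (X k w) + c (X l w) * c (X l w))%:E)).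
  - by apply/measurable_EFinP; apply: measurable_funM; exact: mcX.
  - move=> w _ /=; rewrite lee_fin.
    move: (c (X k w)) (c (X l w)) => a b.
    rewrite [leRHS]ger0_norm; last by rewrite addr_ge0 // -expr2 sqr_ge0.
    by rewrite ler_norml; apply/andP; split; nra.
  - exact: (integrableD measurableT (lawcc k).1 (lawcc l).1).
have covX k l : (\int[P]_w (c (X k w) * c (X l w))%:E
    = (if k == l then fine 'V_nu[idfun] else 0)%:E)%E.
  case: eqVneq => [->|kl].
    by rewrite fineK // VE; exact: (lawcc l).2.
  rewrite (integral_indep_mul _ mc mc (lawc k).1 (lawc l).1 (intXX k l)).
    have := (lawc k).2; rewrite meanc => ->; exact: mul0e.
  move=> A B mA mB.
  pose u := v + box_point t k; pose u' := v + box_point t l.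
  have uu' : u' != u.
    by apply: contra_neq kl => /addrI /box_point_inj.
  (* Independence of the pair is the family statement for the two-element set of these vertices. *)
  have := indep [fset u; u']%fset (fun i => if i == u then A else B).
  rewrite big_fsetU1 ?inE 1?eq_sym // big_seq_fset1 eqxx (negbTE uu').
  move=> <- => [|i]; last by case: ifP.
  congr (P _); apply/seteqP; split => w.
    by move=> [wA wB] i /=; rewrite !inE => /orP[] /eqP ->;
      rewrite ?eqxx ?(negbTE uu').
  move=> hw; split.
    by have := hw u; rewrite /= eqxx !inE eqxx; apply.
  by have := hw u'; rewrite /= (negbTE uu') !inE eqxx orbT; apply.
rewrite -(variance_linear_comb intXX covX) unlock; apply: eq_integral => w _.
congr ((_ ^+ 2)%:E); rewrite /c.
under [RHS]eq_bigr do rewrite mulrBr.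
by rewrite sumrB -mulr_suml h1 mul1r.
Qed.

Theorem corollary6p5 (R : realType) (d : nat) (hd : (1 <= d)%N)
    (nu : probability (measurableTypeR R) R) (mu : R)
    (nu_mean : 'E_nu[idfun]%E = mu%:E)
    (nu_var_fin : 'V_nu[idfun]%E \is a fin_num)
    (nu_var_neq0 : 'V_nu[idfun]%E != 0%E)
    (disp : measure_display) (T : measurableType disp) (P : probability T R)
    (xi : grid d -> {RV P >-> measurableTypeR R})
    (xi_iid : iid_samples xi nu)
    (v : grid d) :
  (fun t : nat =>
     ln (fine 'E_P[fun omega : T =>
       ((jacobi_iter (@grid_gossip R d) d%:R (fun w => xi w omega) t v - mu)
         ^+ 2)%R]%E)
     / ln (t%:R : R)) @ \oo --> - (d%:R : R).
Proof.
have V0 : 0 < fine 'V_nu[idfun]%E.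
  by rewrite fine_gt0 // lt0e nu_var_neq0 variance_ge0 ltey_eq nu_var_fin.
have [C C0 hC] := torus_sum_bound R d hd.
(* With [sigma^2] the variance and [N = 2t + 1], the error lies between [sigma^2 / N^d] and
   [sigma^2 C (4 + 2 ln N)^d / N^d]. *)
apply: (ln_ratio_cvg d (fine 'V_nu[idfun]%E) (fine 'V_nu[idfun]%E * C)) => //
  [|t t0]; first exact: mulr_gt0.
have [h hE] := jacobi_iter_kernel (R := R) (d := d) d%:R t.
have h1 := kernel_sum hd (ler0n R d) hE.
have -> : (fun omega : T => (jacobi_iter (@grid_gossip R d) d%:R
      (fun w => xi w omega) t v - mu) ^+ 2)
    = (fun w => (\sum_k h k * xi (v + box_point t k) w - mu) ^+ 2).
  by apply/funext => w; rewrite hE.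
rewrite (expectation_sqr_kernel nu_mean nu_var_fin xi_iid v t h h1) /=.
have hM := kernel_sqr_sum_ge h h1; rewrite card_ffun !card_ord natrX in hM.
have hU := hC t t0; rewrite -(kernel_sqr_sum hE) natrX in hU.
rewrite ler_pM2l // hM /= -!mulrA ler_pM2l // mulrA.
by rewrite ler_pdivlMr ?exprn_gt0 // mulrC.
Qed.
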